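(* Let $k\ge1$ be an integer with $k<d/2$, let $\sigma,T>0$, $\mathcal P=\mathcal N^{\mathsf g}(k,\sigma)$ with density $p$ and $\mathcal Q=\mathcal N^{\mathsf g}_{\mathsf{trunc}}(k,T,\sigma)$ with density $q$. Let $\boldsymbol\delta\in\mathbb{R}^d$ with $r=\|\boldsymbol\delta\|_2>0$, let $\sigma'=\sqrt{d/(d-2k)}\,\sigma$ and $\nu=\Gamma\mathrm{CDF}_{d/2-k}(T^2/(2\sigma'^2))^{-1}$. For $\lambda_1,\lambda_2\in\mathbb{R}$ define $$R(\lambda_1,\lambda_2)=\Pr_{\boldsymbol\varepsilon\sim\mathcal P}[p(\boldsymbol\varepsilon)<\lambda_1p(\boldsymbol\varepsilon+\boldsymbol\delta)+\lambda_2q(\boldsymbol\varepsilon+\boldsymbol\delta)],$$ $$P(\lambda_1,\lambda_2)=\Pr_{\boldsymbol\varepsilon\sim\mathcal P}[p(\boldsymbol\varepsilon-\boldsymbol\delta)<\lambda_1p(\boldsymbol\varepsilon)+\lambda_2q(\boldsymbol\varepsilon)],\qquad Q(\lambda_1,\lambda_2)=\Pr_{\boldsymbol\varepsilon\sim\mathcal Q}[p(\boldsymbol\varepsilon-\boldsymbol\delta)<\lambda_1p(\boldsymbol\varepsilon)+\lambda_2q(\boldsymbol\varepsilon)].$$ Then, with $t\sim\Gamma(d/2-k,1)$: (i) $R(\lambda_1,\lambda_2)=\mathbb{E}_t[u_1(t)]$ if $\lambda_1\le0$ and $R(\lambda_1,\lambda_2)=\mathbb{E}_t[u_1(t)+u_2(t)]$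 if $\lambda_1>0$, where $$u_1(t)=\mathrm{BetaCDF}_{\frac{d-1}2}\!\left(\frac{\min\{T^2,\,2\sigma'^2kW(\frac tke^{t/k}(\lambda_1+\nu\lambda_2)^{1/k})\}-(\sigma'\sqrt{2t}-r)^2}{4r\sigma'\sqrt{2t}}\right),$$ $$u_2(t)=\max\left\{\mathrm{BetaCDF}_{\frac{d-1}2}\!\left(\frac{2\sigma'^2kW(\frac tke^{t/k}\lambda_1^{1/k})-(\sigma'\sqrt{2t}-r)^2}{4r\sigma'\sqrt{2t}}\right)-\mathrm{BetaCDF}_{\frac{d-1}2}\!\left(\frac{T^2-(\sigma'\sqrt{2t}-r)^2}{4r\sigma'\sqrt{2t}}\right),\,0\right\};$$ (ii) $P(\lambda_1,\lambda_2)=\mathbb{E}_t\big[u_3(t,\lambda_1)\mathbf 1[t\ge T^2/(2\sigma'^2)]+u_3(t,\lambda_1+\nu\lambda_2)\mathbf 1[t<T^2/(2\sigma'^2)]\big]$, where $$u_3(t,\lambda)=\mathrm{BetaCDF}_{\frac{d-1}2}\!\left(\frac{(r+\sigma'\sqrt{2t})^2-2k\sigma'^2W(\frac tke^{t/k}\lambda^{-1/k})}{4r\sigma'\sqrt{2t}}\right);$$ (iii) $Q(\lambda_1,\lambda_2)=\nu\,\mathbb{E}_t\big[u_3(t,\lambda_1+\nu\lambda_2)\,\mathbf 1[t\le T^2/(2\sigma'^2)]\big]$.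
   Context: With $\sigma'=\sqrt{d/(d-2k)}\,\sigma$, $\mathcal N^{\mathsf g}(k,\sigma)$ is the distribution on $\mathbb{R}^d$ with density $\propto\|\boldsymbol\varepsilon\|_2^{-2k}\exp(-\|\boldsymbol\varepsilon\|_2^2/(2\sigma'^2))$, and $\mathcal N^{\mathsf g}_{\mathsf{trunc}}(k,T,\sigma)$ has density $\propto\|\boldsymbol\varepsilon\|_2^{-2k}\exp(-\|\boldsymbol\varepsilon\|_2^2/(2\sigma'^2))\cdot\mathbf 1[\|\boldsymbol\varepsilon\|_2\le T]$. $\Gamma(a,1)$ is the gamma distribution with shape $a$ and scale $1$, $\Gamma\mathrm{CDF}_a$ its CDF. $\mathrm{BetaCDF}_{\frac{d-1}2}$ is the CDF (on all of $\mathbb{R}$) of $\mathrm{Beta}(\frac{d-1}2,\frac{d-1}2)$. $W$ is the principal branch of the Lambert $W$ function. Conventions for $\lambda\le0$: $\lambda^{1/k}$ is read as $0$ and $\lambda^{-1/k}$ as $+\infty$, with $W(+\infty)=+\infty$ and $\mathrm{BetaCDF}(-\infty)=0$. *)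

(* Defs.v *)
From HB Require Import structures.
From mathcomp Require Export all_boot all_order all_algebra.
From mathcomp Require Export all_classical all_reals all_analysis.
From mathcomp Require Import measurable_realfun.

Set Implicit Arguments.
Unset Strict Implicit.
Unset Printing Implicit Defensive.

Export Order.TTheory GRing.Theory Num.Theory.
Export numFieldNormedType.Exports.

#[export] Set Implicit Arguments.
#[export] Unset Strict Implicit.
#[export] Unset Printing Implicit Defensive.

Local Open Scope classical_set_scope.
Local Open Scope ring_scope.

Definition measure_rV_display : measure_display -> measure_display.
Proof. exact. Qed.

Section measurable_rV.
Context {d} {T : sigmaRingType d} (n : nat).

Let coors : 'I_n -> 'rV[T]_n -> T := fun i x => x ord0 i.

Let rV_set0 : g_sigma_preimage coors set0.
Proof. exact: sigma_algebra0. Qed.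

Let rV_setC A : g_sigma_preimage coors A -> g_sigma_preimage coors (~` A).
Proof. exact: sigma_algebraC. Qed.

Let rV_bigcup (F : _^nat) : (forall i, g_sigma_preimage coors (F i)) ->
  g_sigma_preimage coors (\bigcup_i (F i)).
Proof. exact: sigma_algebra_bigcup. Qed.

HB.instance Definition _ := @isMeasurable.Build (measure_rV_display d)
  'rV[T]_n (g_sigma_preimage coors) rV_set0 rV_setC rV_bigcup.

End measurable_rV.

Lemma measurable_coord_rV d (T : sigmaRingType d) n (i : 'I_n) :
  measurable_fun [set: 'rV[T]_n] (fun x : 'rV[T]_n => x ord0 i).
Proof.
move=> _ Y mY; rewrite setTI; apply: sub_sigma_algebra => /=.
rewrite -bigcup_seq/=; exists i => /=; first by rewrite mem_index_enum.
by exists Y => //; rewrite setTI.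
Qed.

Lemma measurable_fun_rVP d1 d2 (T1 : measurableType d1) (T2 : measurableType d2)
    n (f : T1 -> 'rV[T2]_n) :
  (forall i, measurable_fun [set: T1] (fun x => f x ord0 i)) ->
  measurable_fun [set: T1] f.
Proof.
move=> mf.
have h : g_sigma_preimage (fun i => (fun x : 'rV[T2]_n => x ord0 i) \o f)
    `<=` measurable.
  apply: smallest_sub; first exact: sigma_algebra_measurable.
  case: n => [|n] in f mf *; first by rewrite big_ord0.
  rewrite -bigcup_mkord_ord; apply: bigcup_sub => i Ii.
  by move=> A [B mB <-]; exact: mf.
by move=> _ A mA; apply: h; rewrite g_sigma_preimage_comp; exists A.
Qed.

Section lebesgue_rV.
Context {R : realType}.

Definition cons_rV n (p : measurableTypeR R * 'rV[R]_n) : 'rV[R]_n.+1 :=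
  row_mx (p.1%:M : 'rV[R]_1) p.2.

Definition uncons_rV n (v : 'rV[R]_n.+1) : measurableTypeR R * 'rV[R]_n :=
  (v ord0 ord0, \row_j v ord0 (lift ord0 j)).

Lemma cons_rV0 n p : @cons_rV n p ord0 ord0 = p.1.
Proof.
rewrite /cons_rV.
have -> : ord0 = lshift n (ord0 : 'I_1) by exact: val_inj.
by rewrite (@row_mxEl _ _ 1 n) mxE eqxx.
Qed.

Lemma cons_rVS n p j : @cons_rV n p ord0 (lift ord0 j) = p.2 ord0 j.
Proof.
rewrite /cons_rV.
have -> : lift ord0 j = rshift 1 j by exact: val_inj.
by rewrite (@row_mxEr _ _ 1 n).
Qed.

Lemma cons_rVK n : cancel (@cons_rV n) (@uncons_rV n).
Proof.
move=> [x v]; rewrite /uncons_rV cons_rV0; congr pair.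
by apply/rowP => j; rewrite mxE cons_rVS.
Qed.

Lemma uncons_rVK n : cancel (@uncons_rV n) (@cons_rV n).
Proof.
move=> v; apply/rowP => i.
have [j ->|->] := unliftP ord0 i; last by rewrite cons_rV0.
by rewrite cons_rVS mxE.
Qed.

Lemma measurable_cons_rV n : measurable_fun setT (@cons_rV n).
Proof.
apply: measurable_fun_rVP => i.
have [j ->|->] := unliftP ord0 i.
  rewrite (_ : (fun _ => _) = (fun v : 'rV[R]_n => v ord0 j) \o snd).
    exact: measurableT_comp (measurable_coord_rV j) measurable_snd.
  by apply/funext => p; rewrite cons_rVS.
rewrite (_ : (fun _ => _) = fst); first exact: measurable_fst.
by apply/funext => p; rewrite cons_rV0.
Qed.

Lemma measurable_uncons_rV n : measurable_fun setT (@uncons_rV n).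
Proof.
apply/measurable_fun_pair; first exact: measurable_coord_rV.
apply: measurable_fun_rVP => j.
under eq_fun do rewrite mxE.
exact: measurable_coord_rV.
Qed.

Section step.
Context n (m : {sigma_finite_measure set 'rV[R]_n -> \bar R}).

Definition lebesgue_rV_step : set 'rV[R]_n.+1 -> \bar R :=
  pushforward (lebesgue_measure \x m)%E (@cons_rV n).


Let step0 : lebesgue_rV_step set0 = 0%E.
Proof. by rewrite /lebesgue_rV_step /pushforward preimage_set0 measure0. Qed.

Let step_ge0 A : (0 <= lebesgue_rV_step A)%E.
Proof. by rewrite /lebesgue_rV_step /pushforward measure_ge0. Qed.

Let step_sigma_additive : semi_sigma_additive lebesgue_rV_step.
Proof.
have mc := @measurable_cons_rV n.
exact: (@measure_semi_sigma_additive _ _ _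
  (@measure_function_pushforward__canonical__measure_function_Measure
  _ _ _ _ _ (lebesgue_measure \x m)%E _ mc)).
Qed.

HB.instance Definition _ := isMeasure.Build _ _ _ lebesgue_rV_step
  step0 step_ge0 step_sigma_additive.

Let step_sigma_finite : sigma_finite setT lebesgue_rV_step.
Proof.
have /sigma_finiteP[F [TF ndF Foo]] :=
  sigma_finiteT (@lebesgue_measure R).
have /sigma_finiteP[G [TG ndG Goo]] := sigma_finiteT m.
exists (fun i => @uncons_rV n @^-1` (F i `*` G i)).
  rewrite -preimage_bigcup (_ : \bigcup_i _ = setT) ?preimage_setT//.
  rewrite -setXTT TF TG predeqE => -[x y]; split.
    by move=> [i _ []/= ? ?]; split; exists i.
  move=> [/= [i _ Fix] [j _ Gjy]]; exists (maxn i j) => //; split.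
  - by move: x Fix; exact/subsetPset/ndF/leq_maxl.
  - by move: y Gjy; exact/subsetPset/ndG/leq_maxr.
move=> i; have [mFi Fioo] := Foo i; have [mGi Gioo] := Goo i; split.
  rewrite -[X in measurable X]setTI; apply: measurable_uncons_rV => //.
  exact: measurableX.
rewrite /lebesgue_rV_step /pushforward -comp_preimage.
rewrite (_ : _ \o _ = id) ?preimage_id; last first.
  by apply/funext => p /=; rewrite cons_rVK.
by rewrite product_measure1E// lte_mul_pinfty// ge0_fin_numE.
Qed.

HB.instance Definition _ := Measure_isSigmaFinite.Build _ _ _ lebesgue_rV_step
  step_sigma_finite.

End step.

Fixpoint lebesgue_rV n : {sigma_finite_measure set 'rV[R]_n -> \bar R} :=
  if n is n'.+1 then lebesgue_rV_step (lebesgue_rV n') else \d_(0 : 'rV[R]_0).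

Lemma measurable_box_rV n (A : 'I_n -> set R) : (forall i, measurable (A i)) ->
  measurable [set x : 'rV[R]_n | forall i, A i (x ord0 i)].
Proof.
move=> mA.
rewrite (_ : mkset _ =
    \big[setI/setT]_(i < n) ((fun x : 'rV[R]_n => x ord0 i) @^-1` A i)).
  apply: bigsetI_measurable => i _.
  by rewrite -[X in measurable X]setTI; exact: measurable_coord_rV.
apply/seteqP; split=> x /= h.
  by elim/big_ind : _ => // i _; exact: h.
by move=> i; move: h; rewrite (bigD1 i)//= => -[].
Qed.

Lemma lebesgue_rV_box n (A : 'I_n -> set R) : (forall i, measurable (A i)) ->
  lebesgue_rV n [set x : 'rV[R]_n | forall i, A i (x ord0 i)] =
  (\prod_(i < n) lebesgue_measure (A i))%E.
Proof.
elim: n A => [A _|n IH A mA] /=.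
  by rewrite big_ord0 diracE mem_set// => -[].
rewrite big_ord_recl -(IH (fun j => A (lift ord0 j)))//.
rewrite /lebesgue_rV_step /pushforward.
have mB := @measurable_box_rV n (fun j : 'I_n => A (lift ord0 j))
  (fun j => mA (lift ord0 j)).
transitivity ((lebesgue_measure \x lebesgue_rV n)%E (A ord0 `*`
  [set x : 'rV[R]_n | forall j, A (lift ord0 j) (x ord0 j)])); last first.
  exact: (@product_measure1E _ _ (measurableTypeR R) _ _ lebesgue_measure
    (lebesgue_rV n) _ _ (mA ord0) mB).
congr (_ _); apply/seteqP; split=> p /=.
  by move=> h; split=> [|j]; [have := h ord0; rewrite cons_rV0|
    have := h (lift ord0 j); rewrite cons_rVS].
move=> [h0 h] i; have [j ->|->] := unliftP ord0 i.
  by rewrite cons_rVS; exact: h.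
by rewrite cons_rV0.
Qed.

End lebesgue_rV.
Arguments lebesgue_rV : clear implicits.

Section density.
Context d (T : measurableType d) {R : realType}.
Variable mu : {measure set T -> \bar R}.
Implicit Types f w : T -> R.

Definition density_measure (f : T -> R) : set T -> \bar R :=
  fun A => (\int[mu]_(x in A) (f x)%:E)%E.

(* The density proportional to w.  The integral is the real-valued one, which is
   0 when w is not integrable, so this is meaningful for integrable w only. *)
Definition normalize_density (w : T -> R) (x : T) : R := w x / \int[mu]_y w y.

Lemma normalize_density_ge0 w : (forall x, 0 <= w x) ->
  forall x, 0 <= normalize_density w x.
Proof. by move=> w0 x; rewrite divr_ge0//; apply: Rintegral_ge0. Qed.

Lemma measurable_normalize_density w : measurable_fun setT w ->
  measurable_fun setT (normalize_density w).
Proof. by move=> mw; apply: measurable_funM. Qed.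

Lemma density_measure0 f : density_measure f set0 = 0%E.
Proof. by rewrite /density_measure integral_set0. Qed.

Lemma density_measure_ge0 f : (forall x, 0 <= f x) ->
  forall A, (0 <= density_measure f A)%E.
Proof. by move=> f0 A; apply: integral_ge0 => x _; rewrite lee_fin. Qed.

Lemma density_measure_sigma_additive f :
  measurable_fun setT f -> (forall x, 0 <= f x) ->
  semi_sigma_additive (density_measure f).
Proof.
move=> mf f0; apply: semi_sigma_additive_nng_induced.
  exact/measurable_EFinP.
by move=> x; rewrite lee_fin.
Qed.

End density.

Section generalized_gaussian.
Context {R : realType} {d : nat}.
Implicit Types (k : nat) (sigma T : R) (x : 'rV[R]_d).

(* The norm [`|x|] that the library puts on ['rV[R]_d] is the sup norm. *)
Definition l2norm x : R := Num.sqrt (\sum_(i < d) x ord0 i ^+ 2).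

Definition gg_scale k sigma : R := Num.sqrt (d%:R / (d%:R - 2 * k%:R)) * sigma.

(* At the origin, where the density is infinite, this takes the value 0 because
   0^-1 = 0; the origin is Lebesgue-negligible. *)
Definition gg_weight k sigma x : R :=
  l2norm x ^- (2 * k) * expR (- (l2norm x ^+ 2 / (2 * gg_scale k sigma ^+ 2))).

Definition gg_trunc_weight k T sigma x : R :=
  gg_weight k sigma x * (l2norm x <= T)%R%:R.

Definition gg_pdf k sigma : 'rV[R]_d -> R :=
  normalize_density (lebesgue_rV R d) (gg_weight k sigma).

Definition gg_trunc_pdf k T sigma : 'rV[R]_d -> R :=
  normalize_density (lebesgue_rV R d) (gg_trunc_weight k T sigma).

Definition gg_prob k sigma : set 'rV[R]_d -> \bar R :=
  density_measure (lebesgue_rV R d) (gg_pdf k sigma).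

Definition gg_trunc_prob k T sigma : set 'rV[R]_d -> \bar R :=
  density_measure (lebesgue_rV R d) (gg_trunc_pdf k T sigma).

Lemma gg_weight_ge0 k sigma x : 0 <= gg_weight k sigma x.
Proof. by rewrite mulr_ge0 ?expR_ge0// invr_ge0 exprn_ge0// sqrtr_ge0. Qed.

Lemma gg_trunc_weight_ge0 k T sigma x : 0 <= gg_trunc_weight k T sigma x.
Proof. by rewrite mulr_ge0 ?gg_weight_ge0. Qed.

Lemma measurable_l2norm : measurable_fun [set: 'rV[R]_d] l2norm.
Proof.
apply: (@measurableT_comp _ _ _ _ _ _ (@Num.sqrt R)).
  by apply: continuous_measurable_fun; exact: sqrt_continuous.
apply: measurable_sum => i; apply: measurable_funX.
exact: measurable_coord_rV.
Qed.

Lemma measurable_gg_weight k sigma :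
  measurable_fun [set: 'rV[R]_d] (gg_weight k sigma).
Proof.
apply: measurable_funM.
  rewrite (_ : (fun x => _) = (fun x => l2norm x `^ (- (2 * k)%:R))).
    apply: (@measurableT_comp _ _ _ _ _ _ (@powR R ^~ (- (2 * k)%:R))).
      exact: measurable_powR.
    exact: measurable_l2norm.
  by apply/funext => x; rewrite powRN powR_mulrn// sqrtr_ge0.
apply: measurableT_comp; first exact: measurable_expR.
apply: measurableT_comp; first exact: oppr_measurable.
apply: measurable_funM; last exact: measurable_cst.
by apply: measurable_funX; exact: measurable_l2norm.
Qed.

Lemma measurable_gg_trunc_weight k T sigma :
  measurable_fun [set: 'rV[R]_d] (gg_trunc_weight k T sigma).
Proof.
apply: measurable_funM; first exact: measurable_gg_weight.
rewrite (_ : (fun x => _) = (fun x => if l2norm x <= T then 1 else 0)); last first.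
  by apply/funext => x; case: ifP.
apply: measurable_fun_ifT => //.
by apply: measurable_fun_ler => //; exact: measurable_l2norm.
Qed.

Section gg_measure.
Variables (k : nat) (T sigma : R).

HB.instance Definition _ := isMeasure.Build _ _ _ (gg_prob k sigma)
  (density_measure0 _ _)
  (density_measure_ge0 _ (normalize_density_ge0 _ (gg_weight_ge0 k sigma)))
  (density_measure_sigma_additive
    (measurable_normalize_density _ (measurable_gg_weight k sigma))
    (normalize_density_ge0 _ (gg_weight_ge0 k sigma))).

HB.instance Definition _ := isMeasure.Build _ _ _ (gg_trunc_prob k T sigma)
  (density_measure0 _ _)
  (density_measure_ge0 _
    (normalize_density_ge0 _ (gg_trunc_weight_ge0 k T sigma)))
  (density_measure_sigma_additive
    (measurable_normalize_density _ (measurable_gg_trunc_weight k T sigma))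
    (normalize_density_ge0 _ (gg_trunc_weight_ge0 k T sigma))).

End gg_measure.

End generalized_gaussian.
Arguments gg_scale {R} d k sigma.

Section gamma_distribution.
Context {R : realType}.
Notation mu := (@lebesgue_measure R).

Definition gamma_weight (a : R) : R -> R :=
  (fun x => x `^ (a - 1) * expR (- x)) \_ `]0, +oo[.

Definition gamma_fun (a : R) : R := \int[mu]_x gamma_weight a x.

Definition gamma_pdf (a : R) (x : R) : R := gamma_weight a x / gamma_fun a.

Definition gamma_prob (a : R) : set (measurableTypeR R) -> \bar R :=
  density_measure mu (gamma_pdf a).

Definition gamma_cdf (a x : R) : R := fine (gamma_prob a `]-oo, x]).

Lemma gamma_weight_ge0 a x : 0 <= gamma_weight a x.
Proof.
by apply: restrict_ge0 => {}x _; rewrite mulr_ge0 ?powR_ge0 ?expR_ge0.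
Qed.

Lemma measurable_gamma_weight a : measurable_fun [set: R] (gamma_weight a).
Proof.
apply/measurable_restrict => //; apply: measurable_funTS.
apply: measurable_funM; first exact: measurable_powR.
by apply: measurableT_comp; [exact: measurable_expR|exact: oppr_measurable].
Qed.

HB.instance Definition _ a := isMeasure.Build _ _ _ (gamma_prob a)
  (density_measure0 mu _)
  (density_measure_ge0 mu (normalize_density_ge0 mu (gamma_weight_ge0 a)))
  (density_measure_sigma_additive (mu := mu)
    (measurable_normalize_density mu (measurable_gamma_weight a))
    (normalize_density_ge0 mu (gamma_weight_ge0 a))).

End gamma_distribution.

(* The library's [beta_prob] only covers integer shape parameters. *)
Section real_beta_distribution.
Context {R : realType}.
Notation mu := (@lebesgue_measure R).

Definition real_beta_weight (a b : R) : R -> R :=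
  (fun x => x `^ (a - 1) * (1 - x) `^ (b - 1)) \_ `]0, 1[.

Definition real_beta_fun (a b : R) : R := \int[mu]_x real_beta_weight a b x.

Definition real_beta_pdf (a b : R) (x : R) : R :=
  real_beta_weight a b x / real_beta_fun a b.

Definition real_beta_prob (a b : R) : set (measurableTypeR R) -> \bar R :=
  density_measure mu (real_beta_pdf a b).

(* The argument ranges over extended reals: the value at -oo is 0. *)
Definition real_beta_cdf (a b : R) (x : \bar R) : R :=
  fine (real_beta_prob a b [set y | (y%:E <= x)%E]).

Lemma real_beta_weight_ge0 a b x : 0 <= real_beta_weight a b x.
Proof. by apply: restrict_ge0 => {}x _; rewrite mulr_ge0 ?powR_ge0. Qed.

Lemma measurable_real_beta_weight a b :
  measurable_fun [set: R] (real_beta_weight a b).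
Proof.
apply/measurable_restrict => //; apply: measurable_funTS.
apply: measurable_funM; first exact: measurable_powR.
apply: (@measurableT_comp _ _ _ _ _ _ (fun x : R => x `^ (b - 1))).
  exact: measurable_powR.
exact: measurable_funB.
Qed.

HB.instance Definition _ a b := isMeasure.Build _ _ _ (real_beta_prob a b)
  (density_measure0 mu _)
  (density_measure_ge0 mu (normalize_density_ge0 mu (real_beta_weight_ge0 a b)))
  (density_measure_sigma_additive (mu := mu)
    (measurable_normalize_density mu (measurable_real_beta_weight a b))
    (normalize_density_ge0 mu (real_beta_weight_ge0 a b))).

End real_beta_distribution.

Section lambert.
Context {R : realType}.
Implicit Types (x lambda : R).

(* Principal branch: for x >= - e^-1 there is exactly one such w. *)
Definition lambertW x : R := xget 0 [set w | -1 <= w /\ w * expR w = x].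

(* [root_pos] and [inv_root_pos] extend lambda^(1/k) and lambda^(-1/k) by 0 and
   +oo for lambda <= 0; [powR] alone takes the value 1 at negative bases. *)
Definition root_pos (k : nat) lambda : R :=
  if 0 < lambda then lambda `^ (k%:R^-1) else 0.

Definition inv_root_pos (k : nat) lambda : \bar R :=
  if 0 < lambda then (lambda `^ (- k%:R^-1))%:E else +oo%E.

End lambert.

(* Main.v *)
(* The joint law of (<x, delta>, |x|^2) under Lebesgue measure depends on delta
   through its norm only: peeling off one coordinate at a time reduces this to
   rotations of the plane.  Hence, up to a constant, the squared norm u and the
   position y = (1 + cos(x, delta)) / 2 are independent with densities
   u^(d/2 - 1) and Beta((d-1)/2, (d-1)/2).  Multiplying by a radial density
   |x|^(-2k) exp(- |x|^2 / (2 s^2)) and rescaling u = 2 s^2 t turns the first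
   factor into Gamma(d/2 - k), and normalising constants are identified from
   total masses.  Each event compares the density at two points whose squared
   norms are u and (rho - r)^2 + 4 r rho y (or (rho + r)^2 - 4 r rho y); the
   density being decreasing in the norm, solving u^(-k) exp(- u / (2 s^2)) =
   lambda v^(-k) exp(- v / (2 s^2)) for v by Lambert's function turns the event,
   for fixed t, into a union of intervals of y. *)
From HB Require Import structures.
Require Import Defs.
From mathcomp Require Import measurable_realfun ring lra.

Local Open Scope classical_set_scope.
Local Open Scope ring_scope.

(** * Substitutions on the line and in the plane *)

(** The only substitutions made under Lebesgue integrals are affine; the rest is Tonelli's theorem.
    Rotations are products of shears, the squared norm in the plane comes from scaling a disk, and
    each further dimension costs one translation [u = z ^+ 2 + s] at fixed [z]. Multiplicative
    constants, such as the area of the disk, stay existentially quantified until the total mass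
    fixes their product. The hypotheses [1 <= k] and [k < d / 2] force [d >= 3], hence the
    dimensions [n.+3]. The Beta exponents are then at least 1, where the Beta weight is bounded, and
    the induction for the squared norm can start in the plane. The truncated density is [nu] times
    the full one on the ball and 0 outside. Comparing with [l1 * p + l2 * q] therefore means
    comparing with [(l1 + nu * l2) * p] where the argument of [q] lies in the ball and with [l1 * p]
    elsewhere; these are the two coefficients in the formulas. The events are strict inequalities,
    while a distribution function measures closed half-lines; the difference is a finite set of
    [y]. *)

Section line.
Context {R : realType}.
Local Notation mu := (@lebesgue_measure R).
Local Notation mR := (measurableTypeR R).
Local Open Scope ereal_scope.

Lemma measurable_affine (c b : R) :
  measurable_fun [set: mR] (fun x : mR => (c * x + b)%R : mR).
Proof. by apply: measurable_funD => //; apply: measurable_funM. Qed.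

(** The left-hand side is a scaled push-forward, hence a measure, and agrees with Lebesgue measure
    on half-open intervals. *)
Lemma lebesgue_measure_affine (c b : R) (A : set mR) : (0 < c)%R ->
  measurable A -> c%:E * mu ((fun x => c * x + b)%R @^-1` A) = mu A.
Proof.
move=> c0 mA.
have c0' : (0 <= c)%R by exact: ltW.
have mf := measurable_affine c b.
pose nu : {measure set mR -> \bar R} :=
  mscale (NngNum c0')
    (measure_function_pushforward__canonical__measure_function_Measure mu mf).
apply/esym; apply: (@lebesgue_measure_unique R nu) => //= X /ocitvP[->|[[x y]/= xy ->]].
  by rewrite !measure0.
rewrite /nu /mscale/= /pushforward.
rewrite (_ : _ @^-1` _ = `](x - b) / c, (y - b) / c]%classic)%R; last first.
  apply/seteqP; split=> z /=; rewrite !in_itv/= ltr_pdivrMr// ler_pdivlMr//.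
    by move=> /andP[? ?]; apply/andP; split; lra.
  by move=> /andP[? ?]; apply/andP; split; lra.
rewrite !lebesgue_measure_itv/= !lte_fin xy ltr_pM2r ?invr_gt0// ltrD2r xy.
by rewrite -!EFinD -EFinM; congr (_%:E); field; rewrite gt_eqF.
Qed.

Lemma ge0_integral_affine (c b : R) (f : mR -> \bar R) : (0 < c)%R ->
  measurable_fun [set: mR] f -> (forall x, 0 <= f x) ->
  c%:E * \int[mu]_x f (c * x + b)%R = \int[mu]_x f x.
Proof.
move=> c0 mf f0.
have c0' : (0 <= c)%R by exact: ltW.
have ma := measurable_affine c b.
pose m := measure_function_pushforward__canonical__measure_function_Measure mu ma.
rewrite [RHS](eq_measure_integral (mscale (NngNum c0') m)); last first.
  by move=> A mA _; exact/esym/lebesgue_measure_affine.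
rewrite ge0_integral_mscale//=.
by rewrite ge0_integral_pushforward// preimage_setT.
Qed.

Lemma ge0_integral_translate (b : R) (f : mR -> \bar R) :
  measurable_fun [set: mR] f -> (forall x, 0 <= f x) ->
  \int[mu]_x f (x + b)%R = \int[mu]_x f x.
Proof.
move=> mf f0; rewrite -(@ge0_integral_affine 1 b f)// mul1e.
by apply: eq_integral => x _; rewrite mul1r.
Qed.

Lemma ge0_integral_opp (f : mR -> \bar R) :
  measurable_fun [set: mR] f -> (forall x, 0 <= f x) ->
  \int[mu]_x f (- x)%R = \int[mu]_x f x.
Proof.
move=> mf f0.
have mo : measurable_fun [set: mR] (fun x : mR => (- x)%R : mR).
  exact: oppr_measurable.
rewrite [RHS](eq_measure_integral
  (measure_function_pushforward__canonical__measure_function_Measure mu mo)).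
  by rewrite ge0_integral_pushforward// preimage_setT.
by move=> A mA _; exact/esym/lebesgue_measureN.
Qed.

End line.

Section plane.
Context {R : realType}.
Local Notation mu := (@lebesgue_measure R).
Local Notation mR := (measurableTypeR R).
Local Open Scope ereal_scope.
Implicit Types f : mR * mR -> \bar R.

Lemma measurable_lin2 (a b c d : R) : measurable_fun [set: mR * mR]
  (fun p : mR * mR => ((a * p.1 + b * p.2)%R : mR, (c * p.1 + d * p.2)%R : mR)).
Proof.
have h (u v : R) : measurable_fun [set: mR * mR]
    (fun p : mR * mR => (u * p.1 + v * p.2)%R : mR).
  by apply: measurable_funD; apply: measurable_funM.
exact/measurable_fun_pair.
Qed.

Lemma ge0_integral_shear2 (b : R) f :
  measurable_fun [set: mR * mR] f -> (forall p, 0 <= f p) ->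
  \int[mu]_x \int[mu]_y f (x, y + b * x)%R = \int[mu]_x \int[mu]_y f (x, y).
Proof.
move=> mf f0; apply: eq_integral => x _.
apply: (ge0_integral_translate (b * x)%R (f := fun y => f (x, y))) => //.
exact: measurableT_comp.
Qed.

(** The shear moves the outer variable, so the integrals are exchanged before translating. *)
Lemma ge0_integral_shear1 (b : R) f :
  measurable_fun [set: mR * mR] f -> (forall p, 0 <= f p) ->
  \int[mu]_x \int[mu]_y f (x + b * y, y)%R = \int[mu]_x \int[mu]_y f (x, y).
Proof.
move=> mf f0.
pose g (p : mR * mR) := f (p.1 + b * p.2, p.2)%R.
have mg : measurable_fun [set: mR * mR] g.
  apply: measurableT_comp => //; have /= := measurable_lin2 1 b 0 1.
  by under eq_fun do rewrite mul1r mul0r add0r mul1r.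
have g0 p : 0 <= g p by exact: f0.
have -> := fubini_tonelli f mf f0 (m1 := mu) (m2 := mu).
have -> := fubini_tonelli g mg g0 (m1 := mu) (m2 := mu).
apply: eq_integral => y _.
apply: (ge0_integral_translate (b * y)%R (f := fun x => f (x, y))) => //.
exact: measurableT_comp.
Qed.

(* A rotation with nonzero sine is a product of three shears, and shears
   preserve Lebesgue measure by translation invariance and Tonelli. *)
Lemma ge0_integral_rotate (c s : R) f : (c ^+ 2 + s ^+ 2 = 1)%R -> s != 0%R ->
  measurable_fun [set: mR * mR] f -> (forall p, 0 <= f p) ->
  \int[mu]_x \int[mu]_y f (c * x + s * y, c * y - s * x)%R =
  \int[mu]_x \int[mu]_y f (x, y).
Proof.
(* [a] is the tangent of half the angle: shearing by [a], [- s] and [a] again, along alternating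
   axes, gives the rotation, because [s * a = 1 - c] and [a * (1 + c) = s]. *)
move=> cs s0 mf f0; pose a := ((1 - c) / s)%R.
pose g (p : mR * mR) := f (p.1 + a * p.2, p.2)%R.
have mg : measurable_fun [set: mR * mR] g.
  apply: measurableT_comp => //; have /= := measurable_lin2 1 a 0 1.
  by under eq_fun do rewrite mul1r mul0r add0r mul1r.
have g0 p : 0 <= g p by exact: f0.
pose h (p : mR * mR) := g (p.1, p.2 + - s * p.1)%R.
have mh : measurable_fun [set: mR * mR] h.
  apply: measurableT_comp => //; have /= := measurable_lin2 1 0 (- s)%R 1.
  by under eq_fun do rewrite mul1r mul0r addr0 mul1r addrC.
have h0 p : 0 <= h p by exact: g0.
have e1 := ge0_integral_shear1 a mf f0.
have e2 := ge0_integral_shear2 (- s)%R mg g0.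
have e3 := ge0_integral_shear1 a mh h0.
apply: etrans e1; apply: etrans e2; apply: etrans e3.
apply: eq_integral => x _; apply: eq_integral => y _.
rewrite /h /g/= /a; congr (f (_, _)); last by field.
have -> : (c * x + s * y = c * x + s ^+ 2 / s * y)%R by field.
rewrite (_ : s ^+ 2 = 1 - c ^+ 2)%R; last lra.
by field.
Qed.

End plane.

(** * Rotation invariance in Euclidean space *)

Section euclidean.
Context {R : realType}.
Local Notation mu := (@lebesgue_measure R).
Local Notation mR := (measurableTypeR R).

Definition sqnorm n (x : 'rV[R]_n) : R := \sum_(i < n) x ord0 i ^+ 2.

Definition dotrV n (x y : 'rV[R]_n) : R := \sum_(i < n) x ord0 i * y ord0 i.

Lemma sqnorm_ge0 n (x : 'rV[R]_n) : 0 <= sqnorm x.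
Proof. by apply: sumr_ge0 => i _; exact: sqr_ge0. Qed.

Lemma l2norm_sqr n (x : 'rV[R]_n) : l2norm x ^+ 2 = sqnorm x.
Proof. by rewrite sqr_sqrtr// sqnorm_ge0. Qed.

Lemma sqnormD n (x y : 'rV[R]_n) :
  sqnorm (x + y) = sqnorm x + 2 * dotrV x y + sqnorm y.
Proof.
rewrite /sqnorm /dotrV mulr_sumr -!big_split/=; apply: eq_bigr => i _.
by rewrite mxE; ring.
Qed.

Lemma sqnormB n (x y : 'rV[R]_n) :
  sqnorm (x - y) = sqnorm x - 2 * dotrV x y + sqnorm y.
Proof.
rewrite /sqnorm /dotrV mulr_sumr -sumrB -!big_split/=; apply: eq_bigr => i _.
by rewrite !mxE; ring.
Qed.

Lemma sqnorm_cons n (x : mR) (v : 'rV[R]_n) :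
  sqnorm (cons_rV (x, v)) = x ^+ 2 + sqnorm v.
Proof.
by rewrite /sqnorm big_ord_recl cons_rV0; congr (_ + _);
  apply: eq_bigr => i _; rewrite cons_rVS.
Qed.

Lemma dotrV_cons n (x y : mR) (v w : 'rV[R]_n) :
  dotrV (cons_rV (x, v)) (cons_rV (y, w)) = x * y + dotrV v w.
Proof.
by rewrite /dotrV big_ord_recl !cons_rV0; congr (_ + _);
  apply: eq_bigr => i _; rewrite !cons_rVS.
Qed.

Lemma measurable_sqnorm n : measurable_fun [set: 'rV[mR]_n]
  (@sqnorm n : _ -> mR).
Proof.
by apply: measurable_sum => i; apply: measurable_funX; exact: measurable_coord_rV.
Qed.

Lemma measurable_dotrV n (y : 'rV[R]_n) : measurable_fun [set: 'rV[mR]_n]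
  (fun x => dotrV x y : mR).
Proof.
apply: measurable_sum => i; apply: measurable_funM => //.
exact: measurable_coord_rV.
Qed.

Local Open Scope ereal_scope.

(** Lebesgue measure in dimension [n.+1] is by construction the image of a product under
    [cons_rV]. *)
Lemma ge0_integral_rVS n (f : 'rV[mR]_n.+1 -> \bar R) :
  measurable_fun [set: 'rV[mR]_n.+1] f -> (forall x, 0 <= f x) ->
  \int[lebesgue_rV R n.+1]_x f x =
  \int[mu]_x \int[lebesgue_rV R n]_v f (cons_rV (x, v)).
Proof.
move=> mf f0.
have mc := @measurable_cons_rV R n.
have h := @ge0_integral_pushforward _ _ _ _ R _ mc
  (mu \x lebesgue_rV R n)%E setT f measurableT mf (fun y _ => f0 y).
apply: etrans h _; rewrite preimage_setT.
have mfc : measurable_fun [set: mR * 'rV[mR]_n] (f \o @cons_rV R n).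
  exact: measurableT_comp.
exact: (fubini_tonelli1 (m1 := mu) (m2 := lebesgue_rV R n) _ mfc (fun p => f0 _)).
Qed.

Lemma measurable_dot_sqnorm n (y : 'rV[R]_n) :
  measurable_fun [set: 'rV[mR]_n] (fun x => (dotrV x y : mR, sqnorm x : mR)).
Proof.
by apply/measurable_fun_pair; [exact: measurable_dotrV|exact: measurable_sqnorm].
Qed.

Lemma rV1_cons (y : 'rV[R]_1) : y = cons_rV (y ord0 ord0 : mR, 0%R : 'rV[R]_0).
Proof. by apply/rowP => i; rewrite (ord1 i) cons_rV0. Qed.

Lemma rV_cons n (y : 'rV[R]_n.+1) :
  y = cons_rV (y ord0 ord0 : mR, \row_j y ord0 (lift ord0 j)).
Proof. by rewrite -[LHS]uncons_rVK. Qed.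

Lemma ge0_integral_rV0 (f : 'rV[mR]_0 -> \bar R) :
  measurable_fun [set: 'rV[mR]_0] f ->
  \int[lebesgue_rV R 0]_x f x = f 0%R.
Proof. by move=> mf; rewrite /= integral_dirac// diracT mul1e. Qed.

(** What is left of the integral once two coordinates are singled out: the other [n] enter through
    their squared norm only and do not take part in the rotation. *)
Let tail n (F : mR * mR -> \bar R) (p : mR * mR) :=
  \int[lebesgue_rV R n]_w F (p.1, p.2 + sqnorm w)%R.

Let measurable_tail_arg n (F : mR * mR -> \bar R) :
  measurable_fun [set: mR * mR] F ->
  measurable_fun [set: (mR * mR) * 'rV[mR]_n]
    (fun q : (mR * mR) * 'rV[mR]_n => F (q.1.1, q.1.2 + sqnorm q.2)%R).
Proof.
move=> mF; apply: measurableT_comp => //; apply/measurable_fun_pair => /=.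
  exact: measurableT_comp.
apply: measurable_funD; first exact: measurableT_comp.
by apply: measurableT_comp => //; exact: measurable_sqnorm.
Qed.

Let measurable_tail n (F : mR * mR -> \bar R) :
  measurable_fun [set: mR * mR] F -> (forall p, 0 <= F p) ->
  measurable_fun [set: mR * mR] (tail n F).
Proof.
move=> mF F0.
pose f (q : (mR * mR) * 'rV[mR]_n) := F (q.1.1, q.1.2 + sqnorm q.2)%R.
apply: (@measurable_fun_fubini_tonelli_F _ _ _ _ R (lebesgue_rV R n) f).
  exact: measurable_tail_arg.
by move=> q; exact: F0.
Qed.

(** The reflection of the line takes the place of a rotation when only one coordinate of [y]
    matters. *)
Lemma ge0_integral_abs (F : mR * mR -> \bar R) (c : R) :
  measurable_fun [set: mR * mR] F -> (forall p, 0 <= F p) ->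
  \int[mu]_x F (c * x, x ^+ 2)%R = \int[mu]_x F (`|c| * x, x ^+ 2)%R.
Proof.
move=> mF F0; have [//|c0] := ger0P c.
rewrite -(@ge0_integral_opp _ (fun x => F (- c * x, x ^+ 2)%R))//.
  by apply: eq_integral => x _; rewrite mulrNN sqrrN.
apply: measurableT_comp => //; apply/measurable_fun_pair => /=.
  exact: measurable_funM.
exact: measurable_funX.
Qed.

(** Induction on the dimension. For a fixed first coordinate [x], the induction hypothesis aligns
    the tail of [y] with one axis [z]; the inner product then involves [x] and [z] alone, and a
    rotation of their plane turns it into [l2norm y] times one coordinate. *)
Lemma ge0_integral_dot_sqnorm n (y : 'rV[R]_n.+1) (F : mR * mR -> \bar R) :
  measurable_fun [set: mR * mR] F -> (forall p, 0 <= F p) ->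
  \int[lebesgue_rV R n.+1]_x F (dotrV x y, sqnorm x) =
  \int[mu]_z \int[lebesgue_rV R n]_w F (l2norm y * z, z ^+ 2 + sqnorm w)%R.
Proof.
elim: n y F => [|n IH] y F mF F0.
  have mG : measurable_fun [set: 'rV[mR]_1] (fun x => F (dotrV x y, sqnorm x)).
    by apply: measurableT_comp => //; exact: measurable_dot_sqnorm.
  rewrite (ge0_integral_rVS mG (fun _ => F0 _)).
  have E (a b : R) : \int[lebesgue_rV R 0]_w F (a, b + sqnorm w)%R = F (a, b).
    rewrite ge0_integral_rV0; first by rewrite /sqnorm big_ord0 addr0.
    apply: measurableT_comp => //; apply/measurable_fun_pair => //=.
    by apply: measurable_funD => //; exact: measurable_sqnorm.
  transitivity (\int[mu]_x F (y ord0 ord0 * x, x ^+ 2)%R).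
    apply: eq_integral => x _; rewrite -[RHS]E; apply: eq_integral => v _.
    rewrite sqnorm_cons (rV1_cons y) dotrV_cons cons_rV0.
    by rewrite [dotrV _ _]big_ord0 addr0 mulrC.
  rewrite ge0_integral_abs//; apply: eq_integral => x _.
  by rewrite E /l2norm big_ord_recl big_ord0 addr0 sqrtr_sqr.
have mG : measurable_fun [set: 'rV[mR]_n.+2] (fun x => F (dotrV x y, sqnorm x)).
  by apply: measurableT_comp => //; exact: measurable_dot_sqnorm.
rewrite (ge0_integral_rVS mG (fun _ => F0 _)).
pose y0 := y ord0 ord0; pose eta : 'rV[R]_n.+1 := \row_j y ord0 (lift ord0 j).
have yE : y = cons_rV (y0 : mR, eta) by exact: rV_cons.
pose r := l2norm y; pose s := l2norm eta.
have rE : (r ^+ 2 = y0 ^+ 2 + s ^+ 2)%R by rewrite !l2norm_sqr yE sqnorm_cons.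
have r0 : (0 <= r)%R by exact: sqrtr_ge0.
have s0 : (0 <= s)%R by exact: sqrtr_ge0.
have mT := measurable_tail n mF F0.
have T0 p : 0 <= tail n F p by exact: integral_ge0.
transitivity (\int[mu]_x \int[mu]_z tail n F (y0 * x + s * z, x ^+ 2 + z ^+ 2)%R).
  apply: eq_integral => x _.
  (* [Fx] absorbs the fixed first coordinate; this is why the induction quantifies over [F]. *)
  pose Fx (p : mR * mR) := F (y0 * x + p.1, x ^+ 2 + p.2)%R.
  have mFx : measurable_fun [set: mR * mR] Fx.
    apply: measurableT_comp => //; apply/measurable_fun_pair => /=;
      exact: measurable_funD.
  transitivity (\int[lebesgue_rV R n.+1]_v Fx (dotrV v eta, sqnorm v)).
    apply: eq_integral => v _.
    by rewrite yE dotrV_cons sqnorm_cons mulrC.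
  rewrite (IH eta Fx mFx (fun _ => F0 _)).
  apply: eq_integral => z _; apply: eq_integral => w _.
  by rewrite /Fx/= addrA.
(* Peeling one more coordinate off the right-hand side makes both sides integrals of [tail n F] over
   the plane. *)
transitivity (\int[mu]_x \int[mu]_z tail n F (r * x, x ^+ 2 + z ^+ 2)%R); last first.
  apply: eq_integral => x _.
  pose Gx (v : 'rV[mR]_n.+1) := F (r * x, x ^+ 2 + sqnorm v)%R.
  have mGx : measurable_fun [set: 'rV[mR]_n.+1] Gx.
    apply: measurableT_comp => //; apply/measurable_fun_pair => //=.
    by apply: measurable_funD => //; exact: measurable_sqnorm.
  rewrite -[RHS]/(\int[lebesgue_rV R n.+1]_v Gx v) (ge0_integral_rVS mGx (fun _ => F0 _)).
  apply: eq_integral => z _; apply: eq_integral => w _.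
  by rewrite /Gx sqnorm_cons addrA.
(* The rotation has sine [s / r], which must not vanish. If [s = 0], only the sign of [y0] remains
   to be removed. *)
have [s00|sn0] := eqVneq s 0%R.
  have ry : r = `|y0|%R by rewrite -(ger0_norm r0) -!sqrtr_sqr rE s00 expr0n addr0.
  pose H (p : mR * mR) := \int[mu]_z tail n F (p.1, p.2 + z ^+ 2)%R.
  pose K (q : (mR * mR) * mR) := tail n F (q.1.1, q.1.2 + q.2 ^+ 2)%R.
  have mK : measurable_fun [set: (mR * mR) * mR] K.
    apply: measurableT_comp => //; apply/measurable_fun_pair => /=.
      exact: measurableT_comp.
    apply: measurable_funD; first exact: measurableT_comp.
    exact: measurable_funX.
  have mH : measurable_fun [set: mR * mR] H.
    apply: (@measurable_fun_fubini_tonelli_F _ _ _ _ R mu K) => // q.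
    exact: T0.
  have H0 p : 0 <= H p by exact: integral_ge0.
  rewrite s00 ry; apply: etrans (ge0_integral_abs y0 mH H0).
  by apply: eq_integral => x _; apply: eq_integral => z _; rewrite mul0r addr0.
have rn0 : r != 0%R.
  apply/eqP => r00; move: rE; rewrite r00 expr0n/= => /esym/eqP.
  by rewrite paddr_eq0 ?sqr_ge0// !sqrf_eq0 (negbTE sn0) andbF.
pose G (p : mR * mR) := tail n F (r * p.1, p.1 ^+ 2 + p.2 ^+ 2)%R.
have mG' : measurable_fun [set: mR * mR] G.
  apply: measurableT_comp => //; apply/measurable_fun_pair => /=.
    exact: measurable_funM.
  by apply: measurable_funD; apply: measurable_funX.
have cs : ((y0 / r) ^+ 2 + (s / r) ^+ 2 = 1)%R.
  by rewrite !expr_div_n -mulrDl -rE divff// expf_neq0.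
have sr0 : (s / r)%R != 0%R by rewrite mulf_neq0// invr_eq0.
apply: etrans (ge0_integral_rotate cs sr0 mG' (fun p => T0 _)).
apply: eq_integral => x _; apply: eq_integral => z _.
rewrite /G/=; congr (tail n F (_, _)); first by field.
have -> : ((y0 / r * x + s / r * z) ^+ 2 + (y0 / r * z - s / r * x) ^+ 2 =
  ((y0 / r) ^+ 2 + (s / r) ^+ 2) * (x ^+ 2 + z ^+ 2))%R by field.
by rewrite cs mul1r.
Qed.

End euclidean.

(** A nonnegative function with integral 0 vanishes almost everywhere, which would make [A]
    negligible. *)
Lemma ge0_integral_gt0 d (T : measurableType d) (R : realType)
    (mu : {measure set T -> \bar R}) (f : T -> \bar R) (A : set T) :
  measurable_fun setT f -> (forall x, 0 <= f x)%E -> measurable A ->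
  mu A != 0%E -> (forall x, A x -> 0 < f x)%E -> (0 < \int[mu]_x f x)%E.
Proof.
move=> mf f0 mA muA fA; rewrite lt_neqAle integral_ge0// andbT.
apply: contra_neq muA => int0.
have /ae_eq_integral_abs h : measurable_fun setT f by [].
have : (\int[mu]_x `|f x|)%E = 0%E.
  by rewrite int0; apply: eq_integral => x _; rewrite gee0_abs.
move=> /(h mu measurableT) [N [mN muN fN]].
apply/eqP; rewrite eq_le measure_ge0 andbT -muN.
apply: le_measure; rewrite ?inE// => x Ax; apply: fN => /= /(_ I) fx0.
by have := fA _ Ax; rewrite fx0 ltxx.
Qed.

(** * Power weights and the origin of the Beta weight *)

Section power_weight.
Context {R : realType}.
Local Notation mu := (@lebesgue_measure R).
Local Notation mR := (measurableTypeR R).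

(** Up to a constant, the density of the squared norm in dimension [2 * a]. After the substitution
    [s = u - z ^+ 2] the cut-off at 0 expresses the constraint [z ^+ 2 < u]. *)
Definition pow_weight (a : R) : R -> R := (fun s => s `^ (a - 1)) \_ `]0, +oo[.

Lemma pow_weight_gt0E a s : 0 < s -> pow_weight a s = s `^ (a - 1).
Proof. by move=> s0; rewrite /pow_weight patchE mem_set//= in_itv/= s0. Qed.

Lemma pow_weight_le0E a s : s <= 0 -> pow_weight a s = 0.
Proof.
move=> s0; rewrite /pow_weight patchE memNset//= in_itv/= andbT.
by apply/negP; rewrite -leNgt.
Qed.

Lemma pow_weight_ge0 a s : 0 <= pow_weight a s.
Proof. by apply: restrict_ge0 => {}s _; rewrite powR_ge0. Qed.

Lemma measurable_pow_weight a : measurable_fun [set: mR] (pow_weight a : mR -> mR).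
Proof.
by apply/measurable_restrict => //; apply: measurable_funTS; exact: measurable_powR.
Qed.

Lemma real_beta_weight01 (a b x : R) : 0 < x < 1 ->
  real_beta_weight a b x = x `^ (a - 1) * (1 - x) `^ (b - 1).
Proof. by move=> x01; rewrite /real_beta_weight patchE mem_set//= in_itv/= x01. Qed.

Lemma real_beta_weight_out (a b x : R) : ~~ (0 < x < 1) ->
  real_beta_weight a b x = 0.
Proof.
by move=> x01; rewrite /real_beta_weight patchE memNset//= in_itv/=; exact/negP.
Qed.

(** The two cut-offs match because [x * (1 - x)] is positive exactly on []0, 1[]. *)
Lemma pow_weight_beta (a u x : R) : 0 < u ->
  pow_weight a (u * (x * (1 - x))) = u `^ (a - 1) * real_beta_weight a a x.
Proof.
move=> u0; case: (boolP (0 < x < 1)) => [/andP[x0 x1]|x01].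
  have y0 : 0 < 1 - x by rewrite subr_gt0.
  rewrite pow_weight_gt0E ?mulr_gt0// real_beta_weight01 ?x0//.
  rewrite powRM ?(ltW u0)//; last by rewrite ltW// mulr_gt0.
  by rewrite powRM// ltW.
rewrite real_beta_weight_out// mulr0 pow_weight_le0E// pmulr_rle0//.
have [x0|x0] := leP x 0; first by rewrite mulr_le0_ge0// subr_ge0; lra.
move: x01; rewrite x0/= -leNgt => x1.
by rewrite mulr_ge0_le0 ?(ltW x0)// subr_le0.
Qed.

Local Open Scope ereal_scope.

Lemma measurable_fun_integral2 d (T : measurableType d)
    (m : {sigma_finite_measure set T -> \bar R}) (f : mR * T -> \bar R) :
  measurable_fun setT f -> (forall p, 0 <= f p) ->
  measurable_fun [set: mR] (fun x => \int[m]_y f (x, y)).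
Proof. by move=> mf f0; exact: (@measurable_fun_fubini_tonelli_F _ _ _ _ R m f). Qed.

(* Substitute u = z^2 + s, exchange the integrals, then z = sqrt u * (2 b - 1). *)
Lemma ge0_integral_paraboloid (a : R) (F : mR * mR -> \bar R) :
  measurable_fun [set: mR * mR] F -> (forall p, 0 <= F p) ->
  \int[mu]_z \int[mu]_s ((pow_weight a s)%:E * F (z, z ^+ 2 + s)%R) =
  \int[mu]_u ((2 * 4 `^ (a - 1) * pow_weight (a + 2^-1) u)%:E *
    \int[mu]_b ((real_beta_weight a a b)%:E *
      F (Num.sqrt u * (2 * b - 1), u)%R)).
Proof.
move=> mF F0.
pose f (p : mR * mR) := (pow_weight a (p.2 - p.1 ^+ 2))%:E * F p.
have f0 p : 0 <= f p by rewrite mule_ge0// lee_fin pow_weight_ge0.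
have mf : measurable_fun [set: mR * mR] f.
  apply: emeasurable_funM => //; apply/measurable_EFinP.
  apply: (@measurableT_comp _ _ _ _ _ _ (pow_weight a : mR -> mR)).
    exact: measurable_pow_weight.
  by apply: measurable_funB => //; exact: measurable_funX.
transitivity (\int[mu]_z \int[mu]_u f (z, u)).
  apply: eq_integral => z _.
  have mfz : measurable_fun [set: mR] (fun u => f (z, u)).
    exact: measurableT_comp.
  have <- := ge0_integral_translate (z ^+ 2)%R mfz (fun u => f0 _).
  by apply: eq_integral => s _; rewrite /f/= addrK addrC.
have -> := fubini_tonelli f mf f0 (m1 := mu) (m2 := mu).
apply: eq_integral => u _.
have [u0|u0] := leP u 0%R.
  rewrite pow_weight_le0E// mulr0 mul0e; apply: integral0_eq => z _.
  by rewrite /f/= pow_weight_le0E ?mul0e// subr_le0 (le_trans u0)// sqr_ge0.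
have su : (0 < Num.sqrt u)%R by rewrite sqrtr_gt0.
have c0 : (0 < 2 * Num.sqrt u)%R by rewrite mulr_gt0.
have mfu : measurable_fun [set: mR] (fun z => f (z, u)) by exact: measurableT_comp.
have <- := ge0_integral_affine (- Num.sqrt u)%R c0 mfu (fun z => f0 _).
pose g (b : mR) := (real_beta_weight a a b)%:E * F (Num.sqrt u * (2 * b - 1), u)%R.
have g0 b : 0 <= g b by rewrite mule_ge0// lee_fin real_beta_weight_ge0.
have mg : measurable_fun [set: mR] g.
  apply: emeasurable_funM.
    by apply/measurable_EFinP; exact: measurable_real_beta_weight.
  apply: measurableT_comp => //; apply/measurable_fun_pair => //=.
  by apply: measurable_funM => //; apply: measurable_funB => //; exact: measurable_funM.
transitivity ((2 * Num.sqrt u)%:E * \int[mu]_b (((4 * u) `^ (a - 1))%:E * g b)).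
  congr (_ * _); apply: eq_integral => b _.
  rewrite /f /g/= muleA -EFinM -pow_weight_beta ?mulr_gt0//.
  have -> : (2 * Num.sqrt u * b + - Num.sqrt u = Num.sqrt u * (2 * b - 1))%R by ring.
  have -> : (u - (Num.sqrt u * (2 * b - 1)) ^+ 2 = 4 * u * (b * (1 - b)))%R.
    by rewrite exprMn sqr_sqrtr ?ltW//; ring.
  by [].
rewrite ge0_integralZl//; last by rewrite lee_fin powR_ge0.
rewrite muleA -EFinM; congr (_%:E * _).
(* The factor [Num.sqrt u] of the affine substitution raises the exponent by one half, which
   accounts for the additional dimension. *)
rewrite pow_weight_gt0E// powRM ?(ltW u0)//.
have -> : (a + 2^-1 - 1 = 2^-1 + (a - 1))%R by ring.
rewrite (@powRD _ u 2^-1 (a - 1)); last by rewrite (gt_eqF u0) implybT.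
by rewrite powR12_sqrt ?ltW//; ring.
Qed.

Lemma ge0_integral_scale2 (c : R) (f : mR * mR -> \bar R) : (0 < c)%R ->
  measurable_fun [set: mR * mR] f -> (forall p, 0 <= f p) ->
  \int[mu]_x \int[mu]_y f (x, y) =
  (c ^+ 2)%:E * \int[mu]_x \int[mu]_y f (c * x, c * y)%R.
Proof.
move=> c0 mf f0.
have mh := measurable_fun_integral2 mu mf f0.
have h0 x : 0 <= \int[mu]_y f (x, y) by exact: integral_ge0.
have <- := ge0_integral_affine 0 c0 mh h0.
rewrite expr2 EFinM -muleA; congr (_ * _).
pose g (p : mR * mR) := f (c * p.1, c * p.2)%R.
have mg : measurable_fun [set: mR * mR] g.
  by apply: measurableT_comp => //; apply/measurable_fun_pair => /=;
    exact: measurable_funM.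
have mk := measurable_fun_integral2 mu mg (fun p => f0 _).
rewrite -ge0_integralZl//; last 2 first.
- by move=> x _; exact: integral_ge0.
- by rewrite lee_fin ltW.
apply: eq_integral => x _; rewrite addr0.
have mfx : measurable_fun [set: mR] (fun y => f (c * x, y)%R).
  exact: measurableT_comp.
have <- := ge0_integral_affine 0 c0 mfx (fun y => f0 _).
by congr (_ * _); apply: eq_integral => y _; rewrite addr0.
Qed.

End power_weight.

(** * Integration against a density, and normalisation *)

Section density.
Context d (T : measurableType d) {R : realType}.
Variables (mu nu : {measure set T -> \bar R}) (f : T -> R).
Hypotheses (mf : measurable_fun setT f) (f0 : forall x, 0 <= f x).
(** Agreement on measurable sets lets [nu] be [gamma_prob] as well as the push-forward of planar
    measure under the squared norm. *)
Hypothesis nuE : forall A, measurable A -> nu A = density_measure mu f A.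
Local Open Scope ereal_scope.

Let mEf : measurable_fun setT (fun x => (f x)%:E).
Proof. exact/measurable_EFinP. Qed.

Let integral_density_indic (A : set T) : measurable A ->
  \int[nu]_x (\1_A x)%:E = \int[mu]_x ((f x)%:E * (\1_A x)%:E).
Proof.
move=> mA; rewrite integral_indic// setIT nuE// /density_measure integral_mkcond.
apply: eq_integral => x _; rewrite patchE indicE.
by case: ifPn => _; rewrite ?mule1 ?mule0.
Qed.

Import HBNNSimple.

Let integral_density_nnsfun (h : {nnsfun T >-> R}) :
  \int[nu]_x (h x)%:E = \int[mu]_x ((f x)%:E * (h x)%:E).
Proof.
have mi r : measurable_fun setT (fun x => (\1_(h @^-1` [set r]) x : R)%:E).
  exact/measurable_EFinP.
transitivity (\int[nu]_x \sum_(r \in range h) (r * \1_(h @^-1` [set r]) x)%:E).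
  by apply: eq_integral => x _; rewrite fsumEFin// -fimfunE.
rewrite ge0_integral_fsum//; last 2 first.
- by move=> r; exact/measurable_EFinP/measurable_funM.
- by move=> r x _; exact: nnfun_muleindic_ge0.
transitivity (\int[mu]_x \sum_(r \in range h)
    ((f x)%:E * (r * \1_(h @^-1` [set r]) x)%:E)); last first.
  apply: eq_integral => x _; rewrite -ge0_mule_fsumr; last first.
    by move=> r; exact: nnfun_muleindic_ge0.
  by rewrite fsumEFin// -fimfunE.
rewrite ge0_integral_fsum//; last 2 first.
- move=> r; apply: emeasurable_funM => //.
  exact/measurable_EFinP/measurable_funM.
- move=> r x _; apply: mule_ge0; first by rewrite lee_fin.
  exact: nnfun_muleindic_ge0.
apply: eq_fsbigr => r; rewrite inE => -[y _ <-].
under eq_integral do rewrite EFinM.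
rewrite ge0_integralZl//; last by rewrite lee_fin.
rewrite integral_density_indic// -ge0_integralZl//; last 3 first.
- exact: emeasurable_funM.
- by move=> x _; rewrite mule_ge0// lee_fin.
- by rewrite lee_fin.
by apply: eq_integral => x _; rewrite EFinM muleCA.
Qed.

(** Indicators, then simple functions, then monotone convergence on both sides. *)
Lemma ge0_integral_density (g : T -> \bar R) :
  measurable_fun setT g -> (forall x, 0 <= g x) ->
  \int[nu]_x g x = \int[mu]_x ((f x)%:E * g x).
Proof.
move=> mg g0; pose g_ := nnsfun_approx measurableT mg.
have cvg_g x : (g_ n x)%:E @[n --> \oo] --> g x.
  by apply: cvg_nnsfun_approx.
transitivity (limn (fun n => \int[nu]_x (g_ n x)%:E)).
  rewrite -monotone_convergence//=.
  - by apply: eq_integral => x _; apply/esym/cvg_lim => //; exact: cvg_g.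
  - by move=> n; exact/measurable_EFinP.
  - by move=> n x _; rewrite lee_fin.
  - by move=> x _ m n mn; rewrite lee_fin; exact/lefP/nd_nnsfun_approx.
under eq_fun do rewrite integral_density_nnsfun.
rewrite -monotone_convergence//=.
- apply: eq_integral => x _; apply/cvg_lim => //.
  by apply: cvgeZl => //; exact: cvg_g.
- by move=> n; apply: emeasurable_funM => //; exact/measurable_EFinP.
- by move=> n x _; rewrite mule_ge0// lee_fin.
- move=> x _ m n mn; rewrite lee_wpmul2l ?lee_fin//.
  exact/lefP/nd_nnsfun_approx.
Qed.

End density.

Section normalize.
Context d (T : measurableType d) {R : realType}.
Variables (mu : {measure set T -> \bar R}) (w : T -> R).
Hypotheses (mw : measurable_fun setT w) (w0 : forall x, 0 <= w x).
Local Open Scope ereal_scope.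

Lemma density_measure_normalize (A : set T) : measurable A ->
  density_measure mu (normalize_density mu w) A =
  ((\int[mu]_y w y)^-1)%R%:E * \int[mu]_(x in A) (w x)%:E.
Proof.
move=> mA; rewrite -ge0_integralZl//.
- by apply: eq_integral => x _; rewrite -EFinM mulrC.
- by apply: measurable_funTS; exact/measurable_EFinP.
- by move=> x _; rewrite lee_fin.
- by rewrite lee_fin invr_ge0; apply: Rintegral_ge0.
Qed.

Lemma density_measure_normalizeT :
  0 < \int[mu]_x (w x)%:E -> \int[mu]_x (w x)%:E < +oo ->
  density_measure mu (normalize_density mu w) setT = 1.
Proof.
move=> I0 Ioo; rewrite density_measure_normalize//.
have If : \int[mu]_x (w x)%:E \is a fin_num by rewrite ge0_fin_numE// ltW.
rewrite /Rintegral -[X in _ * X]fineK// -EFinM mulVf//.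
by rewrite gt_eqF// fine_gt0// I0.
Qed.

End normalize.

(** * Polar coordinates *)

Section disk.
Context {R : realType}.
Local Notation mu := (@lebesgue_measure R).
Local Notation mR := (measurableTypeR R).
Local Open Scope ereal_scope.

Let N (p : mR * mR) : mR := (p.1 ^+ 2 + p.2 ^+ 2)%R.

Let mN : measurable_fun [set: mR * mR] N.
Proof. by apply: measurable_funD; apply: measurable_funX. Qed.

Let m := measure_function_pushforward__canonical__measure_function_Measure
  (mu \x mu) mN.

Let m_def (A : set mR) : m A = (mu \x mu) (N @^-1` A). Proof. by []. Qed.

Let m_le0 (u : R) : (u <= 0)%R -> m `]-oo, u]%classic = 0.
Proof.
move=> u0; apply/eqP; rewrite eq_le measure_ge0 andbT.
have <- : (mu \x mu) ([set 0%R : mR] `*` [set 0%R : mR]) = 0.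
  have m0 : measurable [set 0%R : mR] by exact: measurable_set1.
  apply: etrans (product_measure1E mu mu m0 m0) _.
  have z : (mu : set mR -> \bar R) [set 0%R : mR] = 0 :=
    lebesgue_measure_set1 (0%R : R).
  by rewrite [X in X * _]z mul0e.
rewrite m_def; apply: le_measure; rewrite ?inE//.
- by rewrite -[X in measurable X]setTI; exact: mN.
- exact: measurableX.
move=> [x y]; rewrite /N/= in_itv/= => xy.
have : (x ^+ 2 + y ^+ 2 == 0)%R.
  by rewrite eq_le (le_trans xy u0) addr_ge0 ?sqr_ge0.
by rewrite paddr_eq0 ?sqr_ge0// !sqrf_eq0 => /andP[/eqP -> /eqP ->].
Qed.

Let m_indic (u : R) : m `]-oo, u]%classic =
  \int[mu]_x \int[mu]_y (\1_(N @^-1` `]-oo, u]) (x, y))%:E.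
Proof.
have mNu : measurable (N @^-1` `]-oo, u]).
  by rewrite -[X in measurable X]setTI; exact: mN.
transitivity (\int[mu \x mu]_p (\1_(N @^-1` `]-oo, u]) p)%:E).
  by rewrite (integral_indic (mu \x mu) measurableT mNu) setIT.
apply: (@fubini_tonelli1 _ _ _ _ _ mu mu
  (fun p => (\1_(N @^-1` `]-oo, u]) p)%:E)).
  exact/measurable_EFinP.
by move=> p; rewrite lee_fin.
Qed.

Let m_gt0 (u : R) : (0 < u)%R -> m `]-oo, u]%classic = u%:E * m `]-oo, 1%R]%classic.
Proof.
move=> u0; rewrite !m_indic.
pose f (p : mR * mR) : \bar R := (\1_(N @^-1` `]-oo, u]) p)%:E.
have mf : measurable_fun [set: mR * mR] f.
  apply/measurable_EFinP; apply: measurable_indic.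
  by rewrite -[X in measurable X]setTI; exact: mN.
have f0 p : 0 <= f p by rewrite lee_fin.
have su : (0 < Num.sqrt u)%R by rewrite sqrtr_gt0.
apply: etrans (ge0_integral_scale2 su mf f0) _.
rewrite [X in X%:E * _](sqr_sqrtr (ltW u0)).
apply: (congr1 (fun I => u%:E * I)).
apply: eq_integral => x _; apply: eq_integral => y _; rewrite /f !indicE.
suff E : (N (Num.sqrt u * x, Num.sqrt u * y)%R <= u)%R = (N (x, y) <= 1)%R.
  congr ((nat_of_bool _)%:R%:E); apply/idP/idP => /=; rewrite !inE/= !in_itv/= => h.
    by rewrite -E.
  by rewrite E.
have -> : N (Num.sqrt u * x, Num.sqrt u * y)%R = (u * (x ^+ 2 + y ^+ 2))%R.
  by rewrite /N/= !exprMn (sqr_sqrtr (ltW u0)); ring.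
by rewrite -ler_pdivlMl// mulVf// gt_eqF.
Qed.

(** The unit disk contains a square of area 1 and lies in one of area 4. *)
Let m1_fin : 0 < m `]-oo, 1%R]%classic < +oo.
Proof.
have m1 : measurable (N @^-1` `]-oo, 1%R]).
  by rewrite -[X in measurable X]setTI; exact: mN.
have sqE (a b : R) : (0 <= b)%R -> (- b <= a <= b)%R = (a ^+ 2 <= b ^+ 2)%R.
  by move=> b0; rewrite -ler_norml -ler_sqr ?nnegrE// real_normK ?num_real.
rewrite m_def; apply/andP; split.
  pose J : set mR := `[(- 2^-1)%R, (2^-1)%R]%classic.
  have mJ : measurable J by exact: measurable_itv.
  have muJ : mu J = 1.
    apply: etrans (lebesgue_measure_itv _) _ => /=.
    by rewrite lte_fin ifT -?EFinD; [congr _%:E; lra|lra].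
  have J1 : (mu \x mu) (J `*` J) = 1.
    by rewrite (product_measure1E mu mu mJ mJ) [X in X * _]muJ [X in _ * X]muJ mule1.
  apply: (lt_le_trans lte01); rewrite -J1.
  apply: le_measure; rewrite ?inE//; first exact: measurableX.
  move=> [x y]/=; rewrite /J/= !in_itv/= !sqE; [|lra|lra].
  by rewrite /N/= => -[? ?]; lra.
pose J : set mR := `[(- 1)%R, 1%R]%classic.
have mJ : measurable J by exact: measurable_itv.
have muJ : mu J = 2%:E.
  apply: etrans (lebesgue_measure_itv _) _ => /=.
  by rewrite lte_fin ifT -?EFinD; [congr _%:E; lra|lra].
have J1 : (mu \x mu) (J `*` J) = 4%:E.
  rewrite (product_measure1E mu mu mJ mJ) [X in X * _]muJ [X in _ * X]muJ.
  by rewrite -EFinM; congr _%:E; lra.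
apply: (@le_lt_trans _ _ 4%:E); last exact: ltry.
rewrite -J1.
apply: le_measure; rewrite ?inE//; first exact: measurableX.
move=> [x y]/=; rewrite /J/= !in_itv/= !sqE//; rewrite /N/= => xy.
by have := sqr_ge0 x; have := sqr_ge0 y; split; lra.
Qed.

Let C : R := fine (m `]-oo, 1%R]%classic).

Let C_gt0 : (0 < C)%R. Proof. by rewrite fine_gt0// m1_fin. Qed.

Let m_itv (u : R) : m `]-oo, u]%classic = (C * Num.max u 0)%:E.
Proof.
have [u0|u0] := leP u 0%R; first by rewrite m_le0// mulr0.
rewrite m_gt0// /C; case/andP: m1_fin => m10 m1oo.
by rewrite mulrC EFinM fineK// ge0_fin_numE// ltW.
Qed.

(** [pow_weight 1] is the indicator of the positive half-line, in the form that starts the induction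
    on the dimension. *)
Let w (s : R) : R := (C * pow_weight 1 s)%R.

Let w0 s : (0 <= w s)%R.
Proof. by rewrite mulr_ge0 ?(ltW C_gt0) ?pow_weight_ge0. Qed.

Let mw : measurable_fun [set: mR] (w : mR -> mR).
Proof. by apply: measurable_funM => //; exact: measurable_pow_weight. Qed.

Let wE (A : set mR) : measurable A ->
  density_measure mu w A = C%:E * mu (A `&` `]0%R, +oo[).
Proof.
move=> mA; rewrite /density_measure.
transitivity (\int[mu]_(x in A) (C%:E * (\1_(`]0%R, +oo[) x)%:E)).
  apply: eq_integral => x _; rewrite /w EFinM; congr (_ * _%:E).
  rewrite indicE /pow_weight patchE; case: ifPn => //= _.
  by rewrite subrr powRr0.
rewrite (ge0_integralZl _ mA) ?lee_fin ?(ltW C_gt0)//; last first.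
  by apply/measurable_EFinP; exact: measurable_indic.
by rewrite integral_indic// setIC.
Qed.

Let mE (A : set mR) : measurable A -> m A = density_measure mu w A.
Proof.
pose nu : set mR -> \bar R := density_measure mu w.
pose nuP := isMeasure.Build _ mR _ nu (@density_measure0 _ mR R mu w)
  (@density_measure_ge0 _ mR R mu w w0)
  (@density_measure_sigma_additive _ mR R mu w mw w0).
pose nuM : {measure set mR -> \bar R} := HB.pack nu nuP.
rewrite -[RHS]/(nuM A).
apply: (@measure_unique _ R mR (@ocitv R) (fun k => `](- k%:R)%R, k%:R%R]%classic)
  _ _ _ _ m nuM) => //.
- exact: ocitvI.
- by move=> k; exact: is_ocitv.
- by rewrite bigcup_itvT.
- move=> B /ocitvP[->|[[a b]/= ab ->]]; first by rewrite !measure0.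
  rewrite -[RHS]/(density_measure mu w _) wE//.
  (* The mass of []a, b]] is found by additivity from the two half-lines, both of finite mass. *)
  have mab : (C * Num.max b 0)%:E = (C * Num.max a 0)%:E + m `]a, b]%classic.
    rewrite -!m_itv -measureU//; last first.
      by apply/seteqP; split=> // x [] /=; rewrite !in_itv/= => ? /andP[]; lra.
    by rewrite -itv_bndbnd_setU ?bnd_simp ?(ltW ab).
  have -> : `]a, b]%classic `&` `]0%R, +oo[%classic = `](Num.max a 0)%R, b]%classic.
    apply/seteqP; split=> x /=; rewrite !in_itv/= andbT gt_max.
      by move=> [/andP[-> ->] ->].
    by move=> /andP[/andP[-> ->] ->].
  rewrite lebesgue_measure_itv/= lte_fin.
  have mo : m `]a, b]%classic = (C * Num.max b 0 - C * Num.max a 0)%:E.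
    by rewrite EFinB mab addeAC subee// add0e.
  rewrite mo -mulrBr; case: ifPn => [h|].
    rewrite -EFinD -EFinM; congr (_ * (_ - _))%:E.
    by move: h; rewrite gt_max => /andP[_ b0]; rewrite max_l// ltW.
  rewrite -leNgt le_max leNgt ab/= => b0.
  rewrite mule0 !max_r//; last by lra.
  by rewrite subrr mulr0.
- move=> k; apply: (@le_lt_trans _ _ (m `]-oo, k%:R]%classic)).
    by apply: le_measure; rewrite ?inE// => x /=; rewrite !in_itv/= => /andP[].
  by rewrite m_itv ltry.
Qed.

(* By scaling, the disk of squared radius u has u times the area of the unit
   disk, so that the squared norm has a constant density. *)
Lemma ge0_integral_disk : exists2 c : R, (0 < c)%R &
  forall G : mR -> \bar R, measurable_fun [set: mR] G -> (forall s, 0 <= G s) ->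
  \int[mu]_x \int[mu]_y G (x ^+ 2 + y ^+ 2)%R =
  c%:E * \int[mu]_s ((pow_weight 1 s)%:E * G s).
Proof.
exists C => // G mG G0.
have mGN : measurable_fun [set: mR * mR] (G \o N) by exact: measurableT_comp.
have <- := @fubini_tonelli1 _ _ _ _ _ mu mu _ mGN (fun p => G0 _).
have <- := ge0_integral_pushforward mN (mu \x mu) measurableT mG (fun y _ => G0 y).
rewrite (ge0_integral_density mw w0 mE mG G0).
rewrite -ge0_integralZl//; last 3 first.
- apply: emeasurable_funM => //.
  by apply/measurable_EFinP; exact: measurable_pow_weight.
- by move=> x _; rewrite mule_ge0// lee_fin pow_weight_ge0.
- by rewrite lee_fin ltW.
by apply: eq_integral => s _; rewrite muleA -EFinM.
Qed.

End disk.

(** * The squared norm and the angle in any dimension *)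

Section radial.
Context {R : realType}.
Local Notation mu := (@lebesgue_measure R).
Local Notation mR := (measurableTypeR R).
Local Open Scope ereal_scope.

Lemma integral_real_beta_weight_gt0 (a b : R) :
  0 < \int[mu]_x (real_beta_weight a b x)%:E.
Proof.
apply: (@ge0_integral_gt0 _ mR _ mu _ `]0%R, 1%R[%classic).
- by apply/measurable_EFinP; exact: measurable_real_beta_weight.
- by move=> x; rewrite lee_fin real_beta_weight_ge0.
- exact: measurable_itv.
- rewrite [X in X != _](_ : _ = 1) ?oner_neq0//.
  apply: etrans (lebesgue_measure_itv _) _ => /=.
  by rewrite lte_fin ltr01 oppr0 adde0.
move=> x /=; rewrite in_itv/= => x01.
rewrite lte_fin real_beta_weight01//; case/andP: x01 => x0 x1.
by rewrite mulr_gt0// powR_gt0// subr_gt0.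
Qed.

(** With nonnegative exponents the weight is at most 1 on []0, 1[]. *)
Lemma integral_real_beta_weight_lty (a b : R) : (1 <= a)%R -> (1 <= b)%R ->
  \int[mu]_x (real_beta_weight a b x)%:E < +oo.
Proof.
move=> a1 b1; have m01 : measurable (`]0%R, 1%R[%classic : set mR).
  exact: measurable_itv.
have powR_le1 (x c : R) : (0 < x <= 1)%R -> (1 <= c)%R -> (x `^ (c - 1) <= 1)%R.
  by move=> x01 c1; rewrite -[leRHS](powRr0 x); apply: ger_powR => //; rewrite subr_ge0.
apply: (@le_lt_trans _ _ (\int[mu]_x (\1_(`]0%R, 1%R[) (x : mR))%:E)).
  apply: ge0_le_integral => //.
  - by move=> x _; rewrite lee_fin real_beta_weight_ge0.
  - by apply/measurable_EFinP; exact: measurable_real_beta_weight.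
  - by apply/measurable_EFinP; exact: measurable_indic.
  move=> x _; rewrite lee_fin indicE; case: (boolP (0 < x < 1)%R) => x01; last first.
    by rewrite real_beta_weight_out.
  rewrite mem_set/= ?in_itv//= real_beta_weight01//.
  case/andP: x01 => x0 x1.
  by rewrite mulr_ile1 ?powR_ge0// powR_le1//; apply/andP; split; lra.
rewrite (integral_indic mu measurableT m01) setIT.
apply: le_lt_trans (ltry 1%R).
rewrite [X in X <= _](_ : _ = 1)//.
apply: etrans (lebesgue_measure_itv _) _ => /=.
by rewrite lte_fin ltr01 oppr0 adde0.
Qed.

Let ge0_integral_rV2 (f : 'rV[mR]_2 -> \bar R) :
  measurable_fun [set: 'rV[mR]_2] f -> (forall x, 0 <= f x) ->
  \int[lebesgue_rV R 2]_x f x =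
  \int[mu]_x \int[mu]_y f (cons_rV (x, cons_rV (y, 0%R : 'rV_0))).
Proof.
move=> mf f0; apply: etrans (ge0_integral_rVS mf f0) _.
apply: eq_integral => x _.
have mfx : measurable_fun [set: 'rV[mR]_1] (fun v => f (cons_rV (x, v))).
  apply: measurableT_comp => //.
  exact: measurableT_comp (@measurable_cons_rV R 1) _.
apply: etrans (ge0_integral_rVS mfx (fun _ => f0 _)) _.
apply: eq_integral => y _; apply: ge0_integral_rV0.
apply: measurableT_comp => //.
apply: (measurableT_comp (@measurable_cons_rV R 1)).
apply/measurable_fun_pair => //=.
apply: (measurableT_comp (@measurable_cons_rV R 0)).
exact/measurable_fun_pair.
Qed.

(** The induction step is [ge0_integral_paraboloid] for an integrand that ignores the first
    coordinate: the Beta integral factors out as a constant. Starting from the plane keeps its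
    exponents at least 1 and avoids the nonlinear substitution [s = x ^+ 2] of dimension 1. *)
Lemma ge0_integral_sqnorm n : exists2 c : R, (0 < c)%R &
  forall G : mR -> \bar R, measurable_fun [set: mR] G -> (forall s, 0 <= G s) ->
  \int[lebesgue_rV R n.+2]_x G (sqnorm x) =
  c%:E * \int[mu]_s ((pow_weight (n.+2%:R / 2) s)%:E * G s).
Proof.
elim: n => [|n [c c0 IH]].
  have [c c0 h] := @ge0_integral_disk R; exists c; first exact: c0.
  move=> G mG G0; rewrite divff//; apply: etrans (h G mG G0).
  have mGs : measurable_fun [set: 'rV[mR]_2] (fun x => G (sqnorm x)).
    by apply: measurableT_comp => //; exact: measurable_sqnorm.
  apply: etrans (ge0_integral_rV2 mGs (fun _ => G0 _)) _.
  apply: eq_integral => x _; apply: eq_integral => y _.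
  by rewrite !sqnorm_cons /sqnorm big_ord0 addr0.
pose a : R := (n.+2%:R / 2)%R.
have a1 : (1 <= a)%R by rewrite /a -[n.+2]addn2 natrD; have := ler0n R n; lra.
pose I := \int[mu]_b (real_beta_weight a a b)%:E.
have I0 : 0 < I by exact: integral_real_beta_weight_gt0.
have Ioo : I < +oo by exact: integral_real_beta_weight_lty.
have IE : I = (fine I)%:E by rewrite fineK// ge0_fin_numE// ltW.
have fI0 : (0 < fine I)%R by rewrite fine_gt0// I0.
pose k : R := (2 * 4 `^ (a - 1))%R.
have k0 : (0 < k)%R by rewrite mulr_gt0// powR_gt0.
exists (c * k * fine I)%R; first by rewrite !mulr_gt0.
move=> G mG G0.
have mGs : measurable_fun [set: 'rV[mR]_n.+3] (fun x => G (sqnorm x)).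
  by apply: measurableT_comp => //; exact: measurable_sqnorm.
apply: etrans (ge0_integral_rVS mGs (fun _ => G0 _)) _.
pose F (p : mR * mR) := G p.2.
have mF : measurable_fun [set: mR * mR] F by exact: measurableT_comp.
pose f (p : mR * mR) := (pow_weight a p.2)%:E * G (p.1 ^+ 2 + p.2)%R.
have f0 p : 0 <= f p by rewrite mule_ge0// lee_fin pow_weight_ge0.
have mf : measurable_fun [set: mR * mR] f.
  apply: emeasurable_funM.
    apply/measurable_EFinP.
    exact: (measurableT_comp (@measurable_pow_weight R a)).
  apply: measurableT_comp => //.
  by apply: measurable_funD => //; exact: measurable_funX.
transitivity (\int[mu]_z (c%:E * \int[mu]_s f (z, s))).
  apply: eq_integral => z _.
  have mGz : measurable_fun [set: mR] (fun s => G (z ^+ 2 + s)%R).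
    by apply: measurableT_comp => //; exact: measurable_funD.
  apply: etrans (IH _ mGz (fun _ => G0 _)).
  by apply: eq_integral => v _; rewrite sqnorm_cons.
rewrite ge0_integralZl//; last 3 first.
- exact: (measurable_fun_integral2 mu mf f0).
- by move=> z _; exact: integral_ge0.
- by rewrite lee_fin ltW.
rewrite -mulrA [in RHS]EFinM -muleA; congr (_ * _).
apply: etrans (ge0_integral_paraboloid a mF (fun _ => G0 _)) _.
rewrite -ge0_integralZl//; last 3 first.
- apply: emeasurable_funM => //.
  by apply/measurable_EFinP; exact: measurable_pow_weight.
- by move=> s _; rewrite mule_ge0// lee_fin pow_weight_ge0.
- by rewrite lee_fin ltW// mulr_gt0.
apply: eq_integral => u _; rewrite /F/=.
rewrite ge0_integralZr//; last 2 first.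
- by apply/measurable_EFinP; exact: measurable_real_beta_weight.
- by move=> b _; rewrite lee_fin real_beta_weight_ge0.
rewrite -/I IE !muleA -!EFinM; congr (_%:E * _).
have -> : (n.+3%:R / 2 = a + 2^-1 :> R)%R by rewrite /a -natr1; lra.
by rewrite /k; ring.
Qed.

(** One coordinate [z] is taken along [y]; the other [n.+2] enter through their squared norm, whence
    the Beta shape [n.+2 / 2]. With [z = Num.sqrt u * (2 * b - 1)], the factor [2 * b - 1] is the
    cosine of the angle with [y]. *)
Lemma ge0_integral_polar n : exists2 c : R, (0 < c)%R &
  forall (y : 'rV[R]_n.+3) (F : mR * mR -> \bar R),
  measurable_fun [set: mR * mR] F -> (forall p, 0 <= F p) ->
  \int[lebesgue_rV R n.+3]_x F (dotrV x y, sqnorm x) =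
  c%:E * \int[mu]_u ((pow_weight (n.+3%:R / 2) u)%:E *
    \int[mu]_b ((real_beta_weight (n.+2%:R / 2) (n.+2%:R / 2) b)%:E *
      F (l2norm y * Num.sqrt u * (2 * b - 1), u)%R)).
Proof.
have [c c0 h] := ge0_integral_sqnorm n.
pose a : R := (n.+2%:R / 2)%R.
pose k : R := (2 * 4 `^ (a - 1))%R.
have k0 : (0 < k)%R by rewrite mulr_gt0// powR_gt0.
exists (c * k)%R; first by rewrite mulr_gt0.
move=> y F mF F0.
apply: etrans (ge0_integral_dot_sqnorm y mF F0) _.
pose G (p : mR * mR) := F (l2norm y * p.1, p.2)%R.
have mG : measurable_fun [set: mR * mR] G.
  by apply: measurableT_comp => //; apply/measurable_fun_pair => //=;
    exact: measurable_funM.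
pose f (p : mR * mR) := (pow_weight a p.2)%:E * G (p.1, p.1 ^+ 2 + p.2)%R.
have f0 p : 0 <= f p by rewrite mule_ge0 ?lee_fin ?pow_weight_ge0//; exact: F0.
have mf : measurable_fun [set: mR * mR] f.
  apply: emeasurable_funM.
    apply/measurable_EFinP.
    exact: (measurableT_comp (@measurable_pow_weight R a)).
  apply: measurableT_comp => //; apply/measurable_fun_pair => //=.
  by apply: measurable_funD => //; exact: measurable_funX.
transitivity (\int[mu]_z (c%:E * \int[mu]_s f (z, s))).
  apply: eq_integral => z _.
  have mGz : measurable_fun [set: mR] (fun s => G (z, z ^+ 2 + s)%R).
    by apply: measurableT_comp => //; apply/measurable_fun_pair => //=;
      exact: measurable_funD.
  exact: (h _ mGz (fun _ => F0 _)).
rewrite ge0_integralZl//; last 3 first.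
- exact: (measurable_fun_integral2 mu mf f0).
- by move=> z _; exact: integral_ge0.
- by rewrite lee_fin ltW.
rewrite EFinM -muleA; congr (_ * _).
apply: etrans (ge0_integral_paraboloid a mG (fun _ => F0 _)) _.
pose g (p : mR * mR) := (real_beta_weight a a p.2)%:E *
  F (l2norm y * Num.sqrt p.1 * (2 * p.2 - 1), p.1)%R.
have g0 p : 0 <= g p by rewrite mule_ge0// lee_fin real_beta_weight_ge0.
have mg : measurable_fun [set: mR * mR] g.
  apply: emeasurable_funM.
    apply/measurable_EFinP.
    exact: (measurableT_comp (measurable_real_beta_weight a a)).
  apply: measurableT_comp => //; apply/measurable_fun_pair => //=.
  apply: measurable_funM.
    apply: measurable_funM => //; apply: measurableT_comp => //.
    by apply: continuous_measurable_fun; exact: sqrt_continuous.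
  by apply: measurable_funB => //; exact: measurable_funM.
rewrite -ge0_integralZl//; last 3 first.
- apply: emeasurable_funM; last exact: (measurable_fun_integral2 mu mg g0).
  by apply/measurable_EFinP; exact: measurable_pow_weight.
- move=> s _; apply: mule_ge0; first by rewrite lee_fin pow_weight_ge0.
  by apply: integral_ge0 => b _; exact: g0 (s, b).
- by rewrite lee_fin ltW.
apply: eq_integral => u _; rewrite muleA -EFinM.
have -> : (n.+3%:R / 2 = a + 2^-1 :> R)%R by rewrite /a -natr1; lra.
congr (_ * _); apply: eq_integral => b _.
by rewrite /G/= mulrA.
Qed.

End radial.

(** * The generalized Gaussian *)

Section gamma_finite.
Context {R : realType}.
Local Notation mu := (@lebesgue_measure R).
Local Notation mR := (measurableTypeR R).

Lemma gamma_weight_gt0E (a x : R) : 0 < x ->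
  gamma_weight a x = x `^ (a - 1) * expR (- x).
Proof. by move=> x0; rewrite /gamma_weight patchE mem_set//= in_itv/= x0. Qed.

Lemma gamma_weight_le0E (a x : R) : x <= 0 -> gamma_weight a x = 0.
Proof.
move=> x0; rewrite /gamma_weight patchE memNset//= in_itv/= andbT.
by apply/negP; rewrite -leNgt.
Qed.

Local Open Scope ereal_scope.

Lemma integral_gamma_weight_gt0 (a : R) : 0 < \int[mu]_x (gamma_weight a x)%:E.
Proof.
apply: (@ge0_integral_gt0 _ mR _ mu _ `]0%R, 1%R[%classic).
- by apply/measurable_EFinP; exact: measurable_gamma_weight.
- by move=> x; rewrite lee_fin gamma_weight_ge0.
- exact: measurable_itv.
- rewrite [X in X != _](_ : _ = 1) ?oner_neq0//.
  apply: etrans (lebesgue_measure_itv _) _ => /=.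
  by rewrite lte_fin ltr01 oppr0 adde0.
move=> x /=; rewrite in_itv/= => /andP[x0 x1].
by rewrite lte_fin gamma_weight_gt0E// mulr_gt0 ?powR_gt0// expR_gt0.
Qed.

Let integral_powR_itv (a e : R) : (0 < a)%R -> (0 < e < 1)%R ->
  \int[mu]_(x in `[e, 1%R]) (x `^ (a - 1))%:E <= (a^-1)%:E.
Proof.
move=> a0 /andP[e0 e1]; pose F (x : R) : R := (a^-1 * x `^ a)%R.
have dF (x : R) : (0 < x)%R -> is_derive x 1%R F (x `^ (a - 1))%R.
  move=> x0; have := is_deriveZ a^-1 (is_derive1_powR a x0).
  by rewrite /GRing.scale/= mulKf// gt_eqF.
have cF (x : R) : (0 < x)%R -> F z @[z --> x] --> F x.
  move=> x0; apply: differentiable_continuous; apply/derivable1_diffP.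
  by have := dF _ x0.
rewrite (@continuous_FTC2 _ _ F)//.
- rewrite /F powR1 mulr1 -EFinB lee_fin gerBl mulr_ge0 ?powR_ge0// invr_ge0.
  exact: ltW.
- apply: derivable_within_continuous => x; rewrite in_itv/= => /andP[ex _].
  by apply: derivable_powR; rewrite in_itv/= andbT (lt_le_trans e0).
- split.
  + by move=> x; rewrite in_itv/= => /andP[ex _]; have := dF x (lt_trans e0 ex).
  + exact/cvg_at_right_filter/cF.
  + exact/cvg_at_left_filter/cF.
- move=> x; rewrite in_itv/= => /andP[ex _].
  by rewrite derive1E; have := dF x (lt_trans e0 ex) => /@derive_val.
Qed.

Lemma integral_powR_le (a : R) : (0 < a)%R ->
  \int[mu]_(x in `]0%R, 1%R]) (x `^ (a - 1))%:E <= (a^-1)%:E.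
Proof.
(* The shift to [n.+2] keeps the left endpoint strictly below 1, as [integral_powR_itv] requires. *)
move=> a0; pose A (n : nat) : set mR := `[n.+2%:R^-1%R, 1%R]%classic.
have mA n : measurable (A n) by exact: measurable_itv.
have UA : \bigcup_n A n = `]0%R, 1%R]%classic.
  apply/seteqP; split=> [x [n _]|x]; rewrite /A/= !in_itv/= => /andP[x0 x1].
    by rewrite x1 andbT (lt_le_trans _ x0)// invr_gt0.
  exists (Num.bound x^-1) => //=; rewrite in_itv/= x1 andbT.
  rewrite invf_ple ?posrE//; apply: ltW.
  apply: (lt_trans (archi_boundP _)); first by rewrite invr_ge0 ltW.
  by rewrite ltr_nat.
have mp (B : set mR) : measurable_fun B (fun x : mR => (x `^ (a - 1))%:E).
  by apply: measurable_funTS; apply/measurable_EFinP; exact: measurable_powR.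
have ndA : {homo A : n m / (n <= m)%N >-> (n <= m)%O}.
  move=> n m nm; apply/subsetPset => x; rewrite /A/= !in_itv/= => /andP[nx ->].
  by rewrite andbT (le_trans _ nx)// lef_pV2 ?posrE ?ltr0n// ler_nat.
have cvgA := @ge0_nondecreasing_set_cvg_integral _ mR R A
  (fun x => (x `^ (a - 1))%:E) mu ndA mA (fun n => mp _)
  (fun n x _ => powR_ge0 x (a - 1)).
rewrite -UA -(cvg_lim _ cvgA)//.
apply: lime_le; first exact: cvgP cvgA.
apply: nearW => n; apply: integral_powR_itv => //.
by rewrite invr_gt0 ltr0n/= invf_lt1// ltr1n.
Qed.

Lemma integral_gamma_weight_lty (a : R) : (0 < a)%R ->
  \int[mu]_x (gamma_weight a x)%:E < +oo.
Proof.
(* Below 1 the exponential is at most 1. Above 1, the exponential series bounds [x ^+ N.+1] by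
   [2 ^+ N.+1 * N.+1!] times [expR (x / 2)]; the remaining [expR (- x / 2)] is twice the exponential
   density of rate one half, hence the leading 2 in [M]. *)
move=> a0; pose N := (Num.bound a); pose M : R := (2 * 2 ^+ N.+1 * N.+1`!%:R)%R.
pose f1 (x : mR) := ((fun x => (x `^ (a - 1))%:E) \_ `]0%R, 1%R]) x.
pose f2 (x : mR) := M%:E * (exponential_pdf 2^-1 x)%:E.
have M0 : (0 <= M)%R by rewrite /M -natrX -!natrM.
have f10 x : 0 <= f1 x by apply: erestrict_ge0 => {}x _; rewrite lee_fin powR_ge0.
have p0 (x : R) : (0 <= exponential_pdf 2^-1 x)%R.
  by rewrite exponential_pdf_ge0.
have f20 x : 0 <= f2 x by rewrite mule_ge0// lee_fin.
have mf1 : measurable_fun [set: mR] f1.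
  apply/(measurable_restrictT _ _).1; first exact: measurable_itv.
  by apply: measurable_funTS; apply/measurable_EFinP; exact: measurable_powR.
have mf2 : measurable_fun [set: mR] f2.
  apply: emeasurable_funM => //; apply/measurable_EFinP.
  exact: measurable_exponential_pdf.
apply: (@le_lt_trans _ _ (\int[mu]_x (f1 x + f2 x))).
  apply: ge0_le_integral => //.
  - by move=> x _; rewrite lee_fin gamma_weight_ge0.
  - by apply/measurable_EFinP; exact: measurable_gamma_weight.
  - exact: emeasurable_funD.
  move=> x _; have [x0|x0] := leP x 0%R.
    by rewrite gamma_weight_le0E// adde_ge0.
  rewrite gamma_weight_gt0E//; have [x1|x1] := leP x 1%R.
    rewrite -[leLHS]adde0 leeD// /f1 patchE mem_set/= ?in_itv/= ?x0//.
    by rewrite lee_fin ler_piMr ?powR_ge0// -expR0 ler_expR lerNl oppr0 ltW.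
  rewrite -[leLHS]add0e leeD// /f2 exponential_pdfE ?(ltW x0)//.
  rewrite -EFinM lee_fin.
  have h := @expR_ge1Dxn R (x / 2) N (divr_ge0 (ltW x0) (ler0n _ 2)).
  have e2 : (expR (- x) = expR (- 2^-1 * x) * expR (- 2^-1 * x))%R.
    by rewrite -expRD; congr expR; lra.
  have e1 : (expR (x / 2) * expR (- 2^-1 * x) = 1)%R.
    by rewrite -expRD -[RHS]expR0; congr expR; lra.
  have ep : (0 < expR (- 2^-1 * x))%R by exact: expR_gt0.
  rewrite e2 !mulrA ler_pM2r//.
  have xN : (x `^ (a - 1) <= x ^+ N.+1)%R.
    rewrite -powR_mulrn ?(ltW x0)//; apply: ler_powR; first exact: ltW.
    have := archi_boundP (ltW a0); rewrite -/N => aN.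
    by rewrite -natr1; lra.
  have hN : (x ^+ N.+1 <= 2 ^+ N.+1 * N.+1`!%:R * expR (x / 2))%R.
    move: h; rewrite expr_div_n => h.
    have F0 : (0 < N.+1`!%:R :> R)%R by rewrite ltr0n fact_gt0.
    have T0 : (0 < 2 ^+ N.+1 :> R)%R by rewrite exprn_gt0.
    have : (x ^+ N.+1 / 2 ^+ N.+1 / N.+1`!%:R <= expR (x / 2))%R by lra.
    by rewrite !ler_pdivrMr// => /le_trans; apply; rewrite mulrC mulrA mulrAC lexx.
  rewrite (le_trans (ler_wpM2r (ltW ep) (le_trans xN hN)))//.
  rewrite -(mulrA _ (expR (x / 2))) e1 /M; lra.
rewrite ge0_integralD// lte_add_pinfty//.
  rewrite -integral_mkcond; apply: le_lt_trans (ltry a^-1).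
  exact: integral_powR_le.
rewrite ge0_integralZl//; last 2 first.
- by apply/measurable_EFinP; exact: measurable_exponential_pdf.
- by move=> x _; rewrite lee_fin.
by rewrite integral_exponential_pdf// mule1 ltry.
Qed.

Lemma gamma_probT (a : R) : (0 < a)%R -> gamma_prob a setT = 1.
Proof.
move=> a0; apply: (@density_measure_normalizeT _ mR).
- exact: measurable_gamma_weight.
- exact: gamma_weight_ge0.
- exact: integral_gamma_weight_gt0.
- exact: integral_gamma_weight_lty.
Qed.

Lemma real_beta_probT (a b : R) : (1 <= a)%R -> (1 <= b)%R ->
  real_beta_prob a b setT = 1.
Proof.
move=> a1 b1; apply: (@density_measure_normalizeT _ mR).
- exact: measurable_real_beta_weight.
- exact: real_beta_weight_ge0.
- exact: integral_real_beta_weight_gt0.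
- exact: integral_real_beta_weight_lty.
Qed.

End gamma_finite.

(** * The radial weight in polar coordinates *)

Section gg_radial.
Context {R : realType}.
Local Notation mu := (@lebesgue_measure R).
Local Notation mR := (measurableTypeR R).

(* The density of the generalized Gaussian in terms of the squared norm u. *)
Definition gg_profile (k : nat) (s u : R) : R :=
  Num.sqrt u ^- (2 * k) * expR (- (Num.sqrt u ^+ 2 / (2 * s ^+ 2))).

Lemma gg_profileE k (s u : R) : 0 < u ->
  gg_profile k s u = u ^- k * expR (- (u / (2 * s ^+ 2))).
Proof. by move=> u0; rewrite /gg_profile exprM sqr_sqrtr// ltW. Qed.

Lemma gg_profile_ge0 k (s u : R) : 0 <= gg_profile k s u.
Proof. by rewrite mulr_ge0 ?expR_ge0// invr_ge0 exprn_ge0// sqrtr_ge0. Qed.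

Lemma measurable_gg_profile k (s : R) :
  measurable_fun [set: mR] (gg_profile k s : mR -> mR).
Proof.
have msqrt : measurable_fun [set: mR] (@Num.sqrt R : mR -> mR).
  by apply: continuous_measurable_fun; exact: sqrt_continuous.
apply: measurable_funM.
  rewrite (_ : (fun x => _) = (fun x => Num.sqrt x `^ (- (2 * k)%:R))).
    by apply: (@measurableT_comp _ _ _ _ _ _ (@powR R ^~ (- (2 * k)%:R)));
      [exact: measurable_powR|].
  by apply/funext => x; rewrite powRN powR_mulrn// sqrtr_ge0.
apply: measurableT_comp; first exact: measurable_expR.
apply: measurableT_comp; first exact: oppr_measurable.
by apply: measurable_funM => //; exact: measurable_funX.
Qed.

Lemma gg_weightE d k (sigma : R) (x : 'rV[R]_d) :
  gg_weight k sigma x = gg_profile k (gg_scale d k sigma) (sqnorm x).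
Proof. by []. Qed.

(** The factor [u ^- k] lowers the shape by [k]: with [a + k = d / 2] the Gamma shape is
    [d / 2 - k]. At [t <= 0] both weights vanish, whatever the default value of the profile. *)
Lemma pow_weight_profile (k : nat) (a s t : R) : 0 < s ->
  pow_weight (a + k%:R) (2 * s ^+ 2 * t) * gg_profile k s (2 * s ^+ 2 * t) =
  (2 * s ^+ 2) `^ (a - 1) * gamma_weight a t.
Proof.
move=> s0; have c0 : 0 < 2 * s ^+ 2 by rewrite mulr_gt0// exprn_gt0.
have [t0|t0] := leP t 0.
  by rewrite gamma_weight_le0E// pow_weight_le0E ?mul0r ?mulr0// pmulr_rle0.
have ct : 0 < 2 * s ^+ 2 * t by rewrite mulr_gt0.
rewrite pow_weight_gt0E// gg_profileE// gamma_weight_gt0E//.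
rewrite (mulrC (2 * s ^+ 2) t) mulfK ?gt_eqF// (mulrC t).
have -> : a + k%:R - 1 = (a - 1) + k%:R by ring.
rewrite powRD ?(gt_eqF ct) ?implybT// powR_mulrn ?(ltW ct)//.
have e (P Q E : R) : Q != 0 -> P * Q * (Q^-1 * E) = P * E by move=> Q0; field.
rewrite e ?expf_neq0 ?gt_eqF// mulrA; congr (_ * _).
by rewrite (@powRM _ (2 * s ^+ 2) t) ?(ltW c0) ?(ltW t0).
Qed.

Local Open Scope ereal_scope.

(* The y for which Phi holds of (<x, delta>, |x|^2), where |delta| = r,
   |x| = s * sqrt(2 t) and x makes with delta an angle of cosine 2 y - 1. *)
Definition polar_section (r s : R) (Phi : set (mR * mR)) (t : R) : set mR :=
  [set y | Phi (r * (s * Num.sqrt (2 * t)) * (2 * y - 1), 2 * s ^+ 2 * t)%R].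

Let mphi (r s : R) : measurable_fun [set: mR * mR] (fun p : mR * mR =>
  ((r * (s * Num.sqrt (2 * p.1)) * (2 * p.2 - 1))%R : mR,
   (2 * s ^+ 2 * p.1)%R : mR)).
Proof.
apply/measurable_fun_pair => /=; last exact: measurable_funM.
apply: measurable_funM.
  apply: measurable_funM => //; apply: measurable_funM => //.
  apply: measurableT_comp.
    by apply: continuous_measurable_fun; exact: sqrt_continuous.
  exact: measurable_funM.
by apply: measurable_funB => //; exact: measurable_funM.
Qed.

Lemma measurable_polar_section (r s : R) (Phi : set (mR * mR)) (t : R) : measurable Phi ->
  measurable (polar_section r s Phi t).
Proof.
move=> mPhi; rewrite -[X in measurable X]setTI.
have h : measurable_fun [set: mR] (fun y : mR =>
  ((r * (s * Num.sqrt (2 * t)) * (2 * y - 1))%R : mR, (2 * s ^+ 2 * t)%R : mR)).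
  apply/measurable_fun_pair => //=; apply: measurable_funM => //.
  by apply: measurable_funB => //; exact: measurable_funM.
exact: (h measurableT Phi mPhi).
Qed.

Let secE (b r s : R) (Phi : set (mR * mR)) (t : R) : measurable Phi ->
  real_beta_prob b b (polar_section r s Phi t) =
  ((real_beta_fun b b)^-1)%:E * \int[mu]_y ((real_beta_weight b b y)%:E *
    (\1_Phi (r * (s * Num.sqrt (2 * t)) * (2 * y - 1), 2 * s ^+ 2 * t)%R)%:E).
Proof.
move=> mPhi.
have h := @density_measure_normalize _ mR R mu (real_beta_weight b b)
  (measurable_real_beta_weight b b) (real_beta_weight_ge0 b b)
  _ (measurable_polar_section r s t mPhi).
apply: etrans h _; congr (_ * _); rewrite integral_mkcond.
apply: eq_integral => y _; rewrite patchE indicE.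
rewrite (_ : (_ \in Phi) = (y \in polar_section r s Phi t)); last first.
  by apply/idP/idP; rewrite !inE.
by case: ifPn => _; rewrite ?mule1 ?mule0.
Qed.

Let F0 (b r s : R) (Phi : set (mR * mR)) (p : mR * mR) : \bar R :=
  (real_beta_weight b b p.2)%:E *
    (\1_Phi (r * (s * Num.sqrt (2 * p.1)) * (2 * p.2 - 1), 2 * s ^+ 2 * p.1)%R)%:E.

Let F0_ge0 b r s Phi p : 0 <= F0 b r s Phi p.
Proof. by rewrite mule_ge0// lee_fin ?real_beta_weight_ge0. Qed.

Let mF0 b r s Phi : measurable Phi -> measurable_fun [set: mR * mR] (F0 b r s Phi).
Proof.
move=> mPhi; apply: emeasurable_funM; apply/measurable_EFinP.
  exact: (measurableT_comp (measurable_real_beta_weight b b)).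
exact: (measurableT_comp (measurable_indic mPhi) (mphi r s)).
Qed.

Lemma measurable_real_beta_polar_section (b r s : R) (Phi : set (mR * mR)) :
  measurable Phi -> measurable_fun [set: mR]
    (fun t : mR => real_beta_prob b b (polar_section r s Phi t)).
Proof.
move=> mPhi; under eq_fun do rewrite secE//.
apply: emeasurable_funM => //.
exact: (measurable_fun_integral2 mu (mF0 b r s mPhi) (F0_ge0 b r s Phi)).
Qed.

Lemma ge0_integral_gg_weight n (k : nat) (sigma : R) (y : 'rV[R]_n.+3) :
  (k%:R < n.+3%:R / 2 :> R)%R -> (0 < sigma)%R ->
  exists2 K : R, (0 < K)%R & forall Phi : set (mR * mR), measurable Phi ->
  \int[lebesgue_rV R n.+3]_x ((gg_weight k sigma x)%:E *
    (\1_Phi (dotrV x y, sqnorm x))%:E) =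
  K%:E * \int[gamma_prob (n.+3%:R / 2 - k%:R)]_t
    real_beta_prob (n.+2%:R / 2) (n.+2%:R / 2)
      (polar_section (l2norm y) (gg_scale n.+3 k sigma) Phi t).
Proof.
move=> kd sigma0; have [c c0 polar] := @ge0_integral_polar R n.
pose b : R := (n.+2%:R / 2)%R; pose a : R := (n.+3%:R / 2 - k%:R)%R.
have a0 : (0 < a)%R by rewrite /a subr_gt0.
have b1 : (1 <= b)%R by rewrite /b -[n.+2]addn2 natrD; have := ler0n R n; lra.
set s := gg_scale _ _ _.
have s0 : (0 < s)%R.
  rewrite /s /gg_scale mulr_gt0// sqrtr_gt0 divr_gt0 ?ltr0n// subr_gt0.
  by move: kd; lra.
pose tau : R := (2 * s ^+ 2)%R.
have tau0 : (0 < tau)%R by rewrite /tau mulr_gt0// exprn_gt0.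
have mgw := @measurable_gamma_weight R a.
have gwp := integral_gamma_weight_gt0 a.
have gwf := integral_gamma_weight_lty a0.
have G0 : (0 < gamma_fun a)%R by rewrite /gamma_fun /Rintegral fine_gt0// gwp.
have bwp := @integral_real_beta_weight_gt0 R b b.
have bwf := @integral_real_beta_weight_lty R b b b1 b1.
have B0 : (0 < real_beta_fun b b)%R.
  by rewrite /real_beta_fun /Rintegral fine_gt0// bwp.
have tp : (0 < tau `^ (a - 1))%R by exact: powR_gt0.
(* The power of [tau] comes from [pow_weight_profile], the other two factors undo the normalisation
   of the Beta and Gamma laws. In the full constant, [tau] is the Jacobian of [u = tau * t] and [c]
   the polar constant. *)
pose K := (tau `^ (a - 1) * (real_beta_fun b b * gamma_fun a))%R.
have K0 : (0 < K)%R by apply: mulr_gt0 => //; exact: mulr_gt0.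
exists (c * (tau * K))%R; first by apply: mulr_gt0 => //; exact: mulr_gt0.
move=> Phi mPhi; set r := l2norm y.
pose F (p : mR * mR) : \bar R := (gg_profile k s p.2)%:E * (\1_Phi p)%:E.
have F_ge0 p : 0 <= F p by rewrite mule_ge0// lee_fin gg_profile_ge0.
have mF : measurable_fun [set: mR * mR] F.
  apply: emeasurable_funM; apply/measurable_EFinP; last exact: measurable_indic.
  exact: (measurableT_comp (measurable_gg_profile k s)).
apply: etrans (polar y F mF F_ge0) _.
rewrite -/b -/r.
pose J (u : mR) := \int[mu]_b0 ((real_beta_weight b b b0)%:E *
  F (r * Num.sqrt u * (2 * b0 - 1), u)%R).
have J0 u : 0 <= J u.
  by apply: integral_ge0 => v _; rewrite mule_ge0// lee_fin real_beta_weight_ge0.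
have mJ : measurable_fun [set: mR] J.
  pose g (p : mR * mR) := (real_beta_weight b b p.2)%:E *
    F (r * Num.sqrt p.1 * (2 * p.2 - 1), p.1)%R.
  apply: (@measurable_fun_integral2 R _ _ mu g) => [|p]; last first.
    by rewrite mule_ge0// lee_fin real_beta_weight_ge0.
  apply: emeasurable_funM.
    apply/measurable_EFinP.
    exact: (measurableT_comp (measurable_real_beta_weight b b)).
  apply: measurableT_comp => //; apply/measurable_fun_pair => //=.
  apply: measurable_funM.
    apply: measurable_funM => //; apply: measurableT_comp => //.
    by apply: continuous_measurable_fun; exact: sqrt_continuous.
  by apply: measurable_funB => //; exact: measurable_funM.
have mpJ : measurable_fun [set: mR] (fun u : mR => (pow_weight (n.+3%:R / 2) u)%:E * J u).
  by apply: emeasurable_funM => //; apply/measurable_EFinP; exact: measurable_pow_weight.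
have pJ0 u : 0 <= (pow_weight (n.+3%:R / 2) u)%:E * J u.
  by rewrite mule_ge0// lee_fin pow_weight_ge0.
rewrite EFinM -[RHS]muleA; congr (_ * _).
apply: etrans (esym (ge0_integral_affine 0 tau0 mpJ pJ0)) _.
rewrite [in RHS]EFinM -[RHS]muleA; congr (_ * _).
pose h (t : mR) := real_beta_prob b b (polar_section r s Phi t).
have mh : measurable_fun [set: mR] h by exact: measurable_real_beta_polar_section.
have h0 t : 0 <= h t by exact: measure_ge0.
have mgp := @measurable_normalize_density _ mR R mu _ mgw.
have gp0 := @normalize_density_ge0 _ mR R mu _ (gamma_weight_ge0 a).
rewrite (@ge0_integral_density _ mR R mu (gamma_prob a) _ mgp gp0 _ h mh h0)//.
rewrite -ge0_integralZl//; last 3 first.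
- apply: emeasurable_funM => //; exact/measurable_EFinP.
- by move=> t _; rewrite mule_ge0// lee_fin gp0.
- by rewrite lee_fin ltW.
apply: eq_integral => t _; rewrite addr0.
have mFt : measurable_fun [set: mR] (fun v : mR => F0 b r s Phi (t, v)).
  by have mF0P := mF0 b r s mPhi; exact: measurableT_comp.
have Jt : J (tau * t)%R = (gg_profile k s (tau * t) * real_beta_fun b b)%:E * h t.
  rewrite /h secE// muleA -EFinM mulfK ?gt_eqF//.
  apply: etrans (ge0_integralZl mu measurableT mFt
    (fun v _ => F0_ge0 b r s Phi (t, v)) (k := (gg_profile k s (tau * t))%:E) _);
    last by rewrite lee_fin gg_profile_ge0.
  apply: eq_integral => v _; rewrite /F/= muleCA.
  have -> : Num.sqrt (tau * t) = (s * Num.sqrt (2 * t))%R.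
    rewrite (_ : tau * t = s ^+ 2 * (2 * t))%R; last by rewrite /tau; ring.
    by rewrite sqrtrM ?sqr_ge0// sqrtr_sqr gtr0_norm.
  by [].
rewrite Jt muleA -EFinM muleA -EFinM; congr (_%:E * _).
rewrite mulrA (_ : n.+3%:R / 2 = a + k%:R)%R; last by rewrite /a subrK.
rewrite pow_weight_profile// /normalize_density -/(gamma_fun a) /K.
by field; rewrite gt_eqF.
Qed.

End gg_radial.

(** * Probabilities under the full and the truncated law *)

Section gg_distribution.
Context {R : realType} (n k : nat) (sigma : R).
Hypotheses (kd : k%:R < n.+3%:R / 2 :> R) (sigma0 : 0 < sigma).
Local Notation mu := (@lebesgue_measure R).
Local Notation mR := (measurableTypeR R).
Local Notation d := n.+3.
Local Notation a := (d%:R / 2 - k%:R : R).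
Local Notation b := (n.+2%:R / 2 : R).
Local Notation s := (gg_scale d k sigma).

Lemma gamma_shape_gt0 : 0 < a. Proof. by rewrite subr_gt0. Qed.

Lemma beta_shape_ge1 : 1 <= b.
Proof. by rewrite -[n.+2]addn2 natrD; have := ler0n R n; lra. Qed.

Lemma gg_scale_gt0 : 0 < s.
Proof.
by rewrite /gg_scale mulr_gt0// sqrtr_gt0 divr_gt0 ?ltr0n// subr_gt0; move: kd; lra.
Qed.

Local Open Scope ereal_scope.

Definition gg_total : R := (\int[lebesgue_rV R d]_x gg_weight k sigma x)%R.

Lemma integral_gg_weight (y : 'rV[R]_d) : (0 < gg_total)%R /\
  forall Phi : set (mR * mR), measurable Phi ->
  \int[lebesgue_rV R d]_x ((gg_weight k sigma x)%:E *
    (\1_Phi (dotrV x y, sqnorm x))%:E) =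
  gg_total%:E * \int[gamma_prob a]_t
    real_beta_prob b b (polar_section (l2norm y) s Phi t).
Proof.
have [K K0 h] := ge0_integral_gg_weight y kd sigma0.
(* The constant is found by taking for Phi the whole plane. *)
suff KE : gg_total = K by rewrite KE.
rewrite /gg_total /Rintegral.
rewrite [X in fine X](_ : _ = \int[lebesgue_rV R d]_x
    ((gg_weight k sigma x)%:E * (\1_setT (dotrV x y, sqnorm x))%:E)); last first.
  by apply: eq_integral => x _; rewrite indicE in_setT mule1.
rewrite h// [X in _ * X](_ : _ = 1) ?mule1//.
transitivity (\int[gamma_prob a]_t (cst 1 t : \bar R)).
  apply: eq_integral => t _; rewrite /= -(real_beta_probT beta_shape_ge1 beta_shape_ge1).
  by congr (real_beta_prob _ _ _); apply/seteqP; split.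
by rewrite integral_cst// mul1e; exact: gamma_probT gamma_shape_gt0.
Qed.

Lemma gg_total_gt0 : (0 < gg_total)%R.
Proof. by have [] := integral_gg_weight 0%R. Qed.

Let mdot (y : 'rV[R]_d) (Phi : set (mR * mR)) : measurable Phi ->
  measurable [set x : 'rV[mR]_d | Phi (dotrV x y, sqnorm x)].
Proof.
move=> mPhi; rewrite -[X in measurable X]setTI.
exact: (@measurable_dot_sqnorm R d y measurableT Phi mPhi).
Qed.

Lemma gg_probE (y : 'rV[R]_d) (Phi : set (mR * mR)) : measurable Phi ->
  gg_prob k sigma [set x : 'rV[R]_d | Phi (dotrV x y, sqnorm x)] =
  \int[gamma_prob a]_t real_beta_prob b b (polar_section (l2norm y) s Phi t).
Proof.
move=> mPhi; have mS := mdot y mPhi.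
have h := @density_measure_normalize _ _ R (lebesgue_rV R d) (gg_weight k sigma)
  (measurable_gg_weight k sigma) (gg_weight_ge0 k sigma) _ mS.
apply: etrans h _; rewrite -/gg_total integral_mkcond.
have [K0 W] := integral_gg_weight y.
rewrite [X in _ * X](_ : _ = \int[lebesgue_rV R d]_x ((gg_weight k sigma x)%:E *
    (\1_Phi (dotrV x y, sqnorm x))%:E)); last first.
  apply: eq_integral => x _; rewrite patchE indicE.
  rewrite (_ : (_ \in Phi) = (x \in [set x | Phi (dotrV x y, sqnorm x)])); last first.
    by apply/idP/idP; rewrite !inE.
  by case: ifPn => _; rewrite ?mule1 ?mule0.
by rewrite W// muleA -EFinM mulVf ?mul1e// gt_eqF.
Qed.

Lemma gg_pdfE (x : 'rV[R]_d) :
  gg_pdf k sigma x = (gg_profile k s (sqnorm x) / gg_total)%R.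
Proof. by []. Qed.

Lemma l2norm_leE (T : R) (x : 'rV[R]_d) : (0 < T)%R ->
  (l2norm x <= T)%R = (sqnorm x <= T ^+ 2)%R.
Proof.
move=> T0; rewrite -l2norm_sqr ler_sqr// nnegrE ?sqrtr_ge0//.
exact: ltW.
Qed.

(** The origin of [nu]: the truncated weight has mass [gg_total] times the probability of the ball,
    and [|x| <= T] reads [t <= T ^+ 2 / (2 * s ^+ 2)] in the Gamma variable. *)
Lemma gg_trunc_pdfE (T : R) (x : 'rV[R]_d) : (0 < T)%R ->
  gg_trunc_pdf k T sigma x =
  ((gamma_cdf a (T ^+ 2 / (2 * s ^+ 2)))^-1 * gg_pdf k sigma x *
    (sqnorm x <= T ^+ 2)%R%:R)%R.
Proof.
move=> T0; rewrite /gg_trunc_pdf /normalize_density.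
set I := (\int[_]_y _)%R.
suff -> : I = (gg_total * gamma_cdf a (T ^+ 2 / (2 * s ^+ 2)))%R.
  by rewrite /gg_trunc_weight l2norm_leE// gg_pdfE gg_weightE invfM; ring.
pose Phi : set (mR * mR) := [set p | p.2 <= T ^+ 2]%R.
have mPhi : measurable Phi.
  rewrite (_ : Phi = snd @^-1` `]-oo, (T ^+ 2)%R]); last first.
    by apply/seteqP; split=> p; rewrite /Phi/= in_itv.
  rewrite -[X in measurable X]setTI.
  exact: (@measurable_snd _ _ mR mR measurableT _ (measurable_itv _)).
(* The ball constrains the squared norm only, so any reference vector serves; each polar section is
   everything or empty. *)
have [K0 W] := integral_gg_weight 0%R.
have tau0 : (0 < 2 * s ^+ 2)%R by rewrite mulr_gt0// exprn_gt0// gg_scale_gt0.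
pose c := (T ^+ 2 / (2 * s ^+ 2))%R.
have mc : measurable (`]-oo, c]%classic : set mR) by exact: measurable_itv.
have gf : gamma_prob a `]-oo, c]%classic \is a fin_num.
  rewrite ge0_fin_numE ?measure_ge0//.
  apply: (@le_lt_trans _ _ (gamma_prob a setT)).
    by apply: le_measure; rewrite ?inE.
  by rewrite (gamma_probT gamma_shape_gt0) ltry.
have E : \int[gamma_prob a]_t
    real_beta_prob b b (polar_section (l2norm (0%R : 'rV[R]_d)) s Phi t) =
    gamma_prob a `]-oo, c]%classic.
  transitivity (\int[gamma_prob a]_t (\1_(`]-oo, c]%classic : set mR) t)%:E).
    apply: eq_integral => t _; rewrite indicE.
    have h : (2 * s ^+ 2 * t <= T ^+ 2)%R = (t <= c)%R.
      by rewrite /c ler_pdivlMr// mulrC.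
    case: (boolP (t <= c)%R) => tc.
      rewrite mem_set/= ?in_itv//= -(real_beta_probT beta_shape_ge1 beta_shape_ge1).
      congr (real_beta_prob _ _ _); apply/seteqP; split => // y _.
      by rewrite /polar_section/= /Phi/= h.
    rewrite memNset/= ?in_itv/=; last exact/negP.
    rewrite -[RHS](measure0 (real_beta_prob b b)).
    congr (real_beta_prob _ _ _); apply/seteqP; split => // y /=.
    by rewrite /polar_section /Phi/= h (negbTE tc).
  by rewrite (integral_indic _ measurableT mc) setIT.
rewrite /I /Rintegral /gamma_cdf -/c.
rewrite (_ : \int[_]_x _ = gg_total%:E * gamma_prob a `]-oo, c]%classic).
  by rewrite fineM.
rewrite -E -W//; apply: eq_integral => z _.
rewrite /gg_trunc_weight EFinM indicE l2norm_leE//; congr (_ * (nat_of_bool _)%:R%:E).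
by apply/idP/idP; rewrite inE.
Qed.

(** Reduces (iii) to an event for the full law. *)
Lemma gg_trunc_probE (T : R) (S : set 'rV[R]_d) : (0 < T)%R ->
  measurable (S : set 'rV[mR]_d) ->
  gg_trunc_prob k T sigma S =
  ((gamma_cdf a (T ^+ 2 / (2 * s ^+ 2)))^-1)%:E *
  gg_prob k sigma (S `&` [set x | sqnorm x <= T ^+ 2]%R).
Proof.
move=> T0 mS; rewrite /gg_trunc_prob /gg_prob /density_measure.
have mB : measurable ([set x | sqnorm x <= T ^+ 2]%R : set 'rV[mR]_d).
  rewrite (_ : [set x | _] = @sqnorm R d @^-1` `]-oo, (T ^+ 2)%R]); last first.
    by apply/seteqP; split=> p /=; rewrite in_itv.
  rewrite -[X in measurable X]setTI.
  exact: (@measurable_sqnorm R d measurableT _ (measurable_itv _)).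
have mp : measurable_fun [set: 'rV[mR]_d] (gg_pdf k sigma : _ -> R).
  exact: measurable_normalize_density (measurable_gg_weight k sigma).
have p0 x : (0 <= gg_pdf (d := d) k sigma x)%R.
  exact: normalize_density_ge0 (gg_weight_ge0 k sigma) x.
rewrite -ge0_integralZl//; last 4 first.
- exact: measurableI.
- by apply: measurable_funTS; exact/measurable_EFinP.
- by move=> x _; rewrite lee_fin.
- by rewrite lee_fin invr_ge0 fine_ge0.
rewrite integral_mkcondr; apply: eq_integral => x _.
rewrite patchE gg_trunc_pdfE//.
case: (boolP (sqnorm x <= T ^+ 2)%R) => xT.
  by rewrite mem_set// mulr1 EFinM.
by rewrite memNset ?mulr0//; exact/negP.
Qed.

End gg_distribution.

(** * The events in polar coordinates *)

Section lambert.
Context {R : realType}.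
Implicit Types x y w u v t m lambda : R.

Lemma ltr_mul_expR x y : 0 <= x -> 0 <= y ->
  (x * expR x < y * expR y) = (x < y).
Proof.
move=> x0 y0; have [xy|yx] := ltP x y.
  by apply: ltr_pM => //; rewrite ?expR_ge0 ?ltr_expR.
by apply/negbTE; rewrite -leNgt ler_pM ?expR_ge0// ler_expR.
Qed.

Lemma lambertW_spec x : 0 <= x ->
  0 <= lambertW x /\ lambertW x * expR (lambertW x) = x.
Proof.
move=> x0; pose f w := w * expR w.
(* The intermediate value theorem applies because [x <= x * expR x]. The root picked by [xget] is
   nonnegative, since [w] and [w * expR w] have the same sign. *)
have [w _ fw] : exists2 w, w \in `[0, x] & f w = x.
  apply: IVT => //.
    apply: continuous_subspaceT => z; apply: cvgM; first exact: cvg_id.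
    exact: continuous_expR.
  rewrite /f mul0r; have xe : x <= x * expR x.
    by rewrite ler_peMr// -expR0 ler_expR.
  by rewrite min_l ?mulr_ge0 ?expR_ge0// max_r ?mulr_ge0 ?expR_ge0// x0.
have w0 : 0 <= w by rewrite -(pmulr_lge0 _ (expR_gt0 w)) -/(f w) fw.
have [_ h] : -1 <= lambertW x /\ lambertW x * expR (lambertW x) = x.
  apply: (@xgetPex R 0 [set w | -1 <= w /\ w * expR w = x]).
  by exists w; split => //; lra.
by split=> //; rewrite -(pmulr_lge0 _ (expR_gt0 (lambertW x))) h.
Qed.

Lemma lt_lambertW x y : 0 <= x -> 0 <= y -> (y < lambertW x) = (y * expR y < x).
Proof.
by move=> x0 y0; have [w0 {2}<-] := lambertW_spec x0; rewrite ltr_mul_expR.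
Qed.

Lemma lambertW_lt x y : 0 <= x -> 0 <= y -> (lambertW x < y) = (x < y * expR y).
Proof.
by move=> x0 y0; have [w0 {2}<-] := lambertW_spec x0; rewrite ltr_mul_expR.
Qed.

Lemma lambertW0 : lambertW 0 = 0 :> R.
Proof.
have [w0 /eqP] := lambertW_spec (lexx (0 : R)).
by rewrite mulf_eq0 (gt_eqF (expR_gt0 _)) orbF => /eqP.
Qed.

Variables (k : nat) (s : R).
Hypotheses (k0 : (0 < k)%N) (s0 : 0 < s).
Let tau := 2 * s ^+ 2.

Let tau0 : 0 < tau. Proof. by rewrite mulr_gt0// exprn_gt0. Qed.
Let kR0 : 0 < k%:R :> R. Proof. by rewrite ltr0n. Qed.
Let tk0 : 0 < tau * k%:R. Proof. exact: mulr_gt0. Qed.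

(** Taking the [k]-th root of [u ^- k * expR (- (u / tau))] leaves the inverse of a multiple of
    [z * expR z] with [z = u / (tau * k)]. Comparing profiles thus means comparing values of
    [z * expR z], which [lambertW] inverts. *)
Let psi u := u / (tau * k%:R) * expR (u / (tau * k%:R)).

Let psi_gt0 u : 0 < u -> 0 < psi u.
Proof. by move=> u0; rewrite mulr_gt0 ?expR_gt0// divr_gt0. Qed.

Let profile_psi u : 0 < u -> gg_profile k s u = (tau * k%:R * psi u) ^- k.
Proof.
move=> u0; rewrite gg_profileE//.
have -> : tau * k%:R * psi u = u * expR (u / (tau * k%:R)).
  by rewrite /psi mulrA; congr (_ * _); field; rewrite !gt_eqF.
rewrite exprMn -expRM_natl [RHS]invfM -expRN; congr (_ * expR _).
by rewrite /tau; field; rewrite !gt_eqF.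
Qed.

Let profile_lt u v m : 0 < u -> 0 < v -> 0 < m ->
  (gg_profile k s u < m ^+ k * gg_profile k s v) = (psi v < m * psi u).
Proof.
move=> u0 v0 m0; rewrite !profile_psi//.
have pu := psi_gt0 u0; have pv := psi_gt0 v0.
have cu : 0 < tau * k%:R * psi u by exact: mulr_gt0.
have cv : 0 < tau * k%:R * psi v by exact: mulr_gt0.
rewrite ltr_pdivlMr ?exprn_gt0// mulrC ltr_pdivrMr ?exprn_gt0// -exprMn.
have mcu : 0 <= m * (tau * k%:R * psi u) by rewrite mulr_ge0 ?(ltW m0) ?(ltW cu).
rewrite ltr_pXn2r ?nnegrE ?(ltW cv)//.
by rewrite (mulrCA m) ltr_pM2l.
Qed.

Let root_exp lambda : 0 < lambda -> lambda = (lambda `^ (k%:R^-1)) ^+ k.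
Proof.
move=> l0; rewrite -powR_mulrn ?powR_ge0// -powRrM mulVf ?gt_eqF//.
by rewrite powRr1// ltW.
Qed.

Let psi_scale t : psi (tau * t) = t / k%:R * expR (t / k%:R).
Proof.
by rewrite /psi (_ : tau * t / (tau * k%:R) = t / k%:R)//; field; rewrite !gt_eqF.
Qed.

Lemma gg_profile_lt_root_pos t v lambda : 0 < t -> 0 < v ->
  (gg_profile k s (2 * s ^+ 2 * t) < lambda * gg_profile k s v) =
  (v < 2 * s ^+ 2 * k%:R *
    lambertW (t / k%:R * expR (t / k%:R) * root_pos k lambda)).
Proof.
move=> t0 v0; rewrite -/tau /root_pos.
have u0 : 0 < tau * t by exact: mulr_gt0.
(* For [lambda <= 0] both sides are false: the profile is nonnegative, and the convention of root 0
   gives the bound 0 for the positive [v]. *)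
have [l0|l0] := ltP 0 lambda; last first.
  rewrite mulr0 lambertW0 mulr0 [RHS]ltNge (ltW v0); apply/negbTE.
  rewrite -leNgt (@le_trans _ _ 0) ?gg_profile_ge0// mulr_le0_ge0//.
  exact: gg_profile_ge0.
rewrite {1}(root_exp l0) profile_lt ?powR_gt0// psi_scale [in LHS]mulrC.
rewrite -[RHS]ltr_pdivrMl// [in RHS](mulrC _ v) lt_lambertW ?divr_ge0 ?(ltW v0) ?(ltW tk0)//.
by rewrite !mulr_ge0 ?expR_ge0 ?powR_ge0 ?invr_ge0 ?(ltW t0) ?(ltW kR0).
Qed.

Lemma gg_profile_lt_inv_root t v lambda : 0 < t -> 0 < v -> 0 < lambda ->
  (gg_profile k s v < lambda * gg_profile k s (2 * s ^+ 2 * t)) =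
  (2 * k%:R * s ^+ 2 *
    lambertW (t / k%:R * expR (t / k%:R) * lambda `^ (- k%:R^-1)) < v).
Proof.
move=> t0 v0 l0; rewrite (mulrAC 2 k%:R) -/tau.
have u0 : 0 < tau * t by exact: mulr_gt0.
rewrite {1}(root_exp l0) profile_lt ?powR_gt0// psi_scale.
rewrite -[RHS]ltr_pdivlMl// [in RHS](mulrC _ v) lambertW_lt ?divr_ge0 ?(ltW v0) ?(ltW tk0)//.
  by rewrite powRN ltr_pdivrMr ?powR_gt0// [in LHS](mulrC _ (psi v)).
by rewrite !mulr_ge0 ?expR_ge0 ?powR_ge0 ?invr_ge0 ?(ltW t0) ?(ltW kR0).
Qed.

End lambert.

(** * Null sets and Beta distribution functions *)

Section pointwise.
Context {R : realType}.
Local Notation mu := (@lebesgue_measure R).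
Local Notation mR := (measurableTypeR R).
Local Open Scope ereal_scope.

(** The exceptional points absorb the passage from strict to weak inequalities; there are two
    because a shifted event may have one threshold inside the ball and one outside. *)
Lemma real_beta_prob_eq (a b x1 x2 : R) (S1 S2 : set mR) :
  measurable S1 -> measurable S2 ->
  (forall y : R, (0 < y < 1)%R -> y != x1 -> y != x2 -> (S1 y <-> S2 y)) ->
  real_beta_prob a b S1 = real_beta_prob a b S2.
Proof.
move=> mS1 mS2 S12.
have mw := measurable_normalize_density mu (measurable_real_beta_weight a b).
have w0 := normalize_density_ge0 mu (real_beta_weight_ge0 a b).
pose g (S : set mR) := (fun x : mR => (real_beta_pdf a b x)%:E) \_ S.
have gE S : real_beta_prob a b S = \int[mu]_x g S x.
  by rewrite /real_beta_prob /density_measure integral_mkcond.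
have m S : measurable S -> measurable_fun [set: mR] (g S).
  move=> mS; apply/(measurable_restrictT _ mS).
  by apply: measurable_funTS; exact/measurable_EFinP.
have ge0 S (x : mR) : 0 <= g S x.
  by apply: erestrict_ge0 => {}x _; rewrite lee_fin; exact: w0.
rewrite !gE; apply: ge0_ae_eq_integral => //; [exact: m|exact: m|].
exists ([set x1] `|` [set x2]); split.
- by apply: measurableU; exact: measurable_set1.
- apply/eqP; rewrite eq_le measure_ge0 andbT.
  apply: le_trans (measureU2 _ _ _) _; [exact: measurable_set1..|].
  have z (x : R) : (mu : set mR -> \bar R) [set x : mR] = 0 := lebesgue_measure_set1 x.
  by rewrite [X in X + _]z [X in _ + X]z adde0.
move=> y /=; apply: contra_notP => /not_orP[/eqP yx1 /eqP yx2] _.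
rewrite /g !patchE; case: (boolP (0 < y < 1)%R) => y01; last first.
  by rewrite /real_beta_pdf real_beta_weight_out// mul0r !if_same.
have h := S12 y y01 yx1 yx2.
by rewrite (_ : (y \in S1) = (y \in S2))//; apply/idP/idP; rewrite !inE => /h.
Qed.

(** [f] will be a formula involving [lambertW]. Its measurability is inherited from [h], with which
    it agrees for [t > 0] off [t0], and from its vanishing for [t <= 0]. *)
Lemma ge0_integral_gamma_eq (a t0 : R) (h : mR -> \bar R) (f : mR -> R) :
  measurable_fun [set: mR] h -> (forall t, 0 <= h t) -> (forall t, 0 <= f t)%R ->
  (forall t : R, (0 < t)%R -> t != t0 -> h t = (f t)%:E) ->
  (forall t : R, (t <= 0)%R -> f t = 0%R) ->
  \int[gamma_prob a]_t h t = \int[gamma_prob a]_t (f t)%:E.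
Proof.
move=> mh h0 f0 hf fle0.
have m1 : measurable [set t0 : mR] by exact: measurable_set1.
have mp : measurable (`]0%R, +oo[%classic : set mR) by exact: measurable_itv.
have mf : measurable_fun [set: mR] (fun t => (f t)%:E).
  rewrite (_ : (fun t => _) = (fun t =>
      ((cst (f t0)%:E \_ [set t0]) t + ((h \_ `]0%R, +oo[) \_ (~` [set t0])) t))).
    apply: emeasurable_funD.
      by apply/(measurable_restrictT _ m1); exact: measurable_cst.
    apply/(measurable_restrictT _ (measurableC m1)); apply: measurable_funTS.
    by apply/(measurable_restrictT _ mp); exact: measurable_funTS.
  apply/funext => t; rewrite !patchE in_setC.
  have [->|tt0] := eqVneq t t0; first by rewrite mem_set//= adde0.
  rewrite (memNset (A := [set t0])) ?add0e/=; last exact/eqP.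
  have [tle|tgt] := leP t 0%R.
    by rewrite fle0// memNset//= in_itv/= andbT; apply/negP; rewrite -leNgt.
  by rewrite mem_set/= ?in_itv/= ?tgt// hf.
have mg := measurable_normalize_density mu (measurable_gamma_weight a).
have g0 := normalize_density_ge0 mu (gamma_weight_ge0 a).
have E := @ge0_integral_density _ mR R mu (gamma_prob a) _ mg g0 (fun _ _ => erefl).
have f0' t : 0 <= (f t)%:E by rewrite lee_fin.
apply: etrans (E _ mh h0) _; apply: etrans _ (esym (E _ mf f0')).
apply: ge0_ae_eq_integral => //.
- by apply: emeasurable_funM => //; exact/measurable_EFinP.
- by apply: emeasurable_funM => //; exact/measurable_EFinP.
- by move=> t _; rewrite mule_ge0// lee_fin g0.
- by move=> t _; rewrite mule_ge0// lee_fin g0.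
exists [set t0]; split => //; first exact: lebesgue_measure_set1.
move=> t /=; apply: contra_notP => /eqP tt0 _.
have [tle|tgt] := leP t 0%R; last by rewrite hf.
by rewrite /normalize_density gamma_weight_le0E// mul0r !mul0e.
Qed.

Variables a b : R.
Hypotheses (a1 : (1 <= a)%R) (b1 : (1 <= b)%R).

Lemma real_beta_prob_fin (S : set mR) : measurable S ->
  real_beta_prob a b S \is a fin_num.
Proof.
move=> mS; rewrite ge0_fin_numE ?measure_ge0//.
apply: (@le_lt_trans _ _ (real_beta_prob a b setT)).
  by apply: le_measure; rewrite ?inE.
by rewrite real_beta_probT// ltry.
Qed.

Lemma real_beta_cdfE (x : R) :
  (real_beta_cdf a b x%:E)%:E = real_beta_prob a b `]-oo, x]%classic.
Proof.
rewrite /real_beta_cdf (_ : [set y | _] = `]-oo, x]%classic); last first.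
  by apply/seteqP; split=> y /=; rewrite in_itv/= lee_fin.
by rewrite fineK//; apply: real_beta_prob_fin; exact: measurable_itv.
Qed.

Lemma real_beta_cdfNy : real_beta_cdf a b -oo = 0%R.
Proof.
rewrite /real_beta_cdf (_ : [set y | _] = set0) ?measure0//.
by apply/seteqP; split=> y.
Qed.

Lemma real_beta_cdf_le0 (x : R) : (x <= 0)%R -> real_beta_cdf a b x%:E = 0%R.
Proof.
move=> x0; apply: EFin_inj; rewrite real_beta_cdfE.
rewrite (@real_beta_prob_eq _ _ 0 0 _ set0) ?measure0//.
move=> y /andP[y0 _] _ _; split=> //; rewrite /= in_itv/= => yx.
by have := lt_le_trans y0 (le_trans yx x0); rewrite ltxx.
Qed.

Lemma real_beta_cdf_ge0 (x : \bar R) : (0 <= real_beta_cdf a b x)%R.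
Proof. by rewrite fine_ge0// measure_ge0. Qed.

End pointwise.

(** * Sections of the events as intervals *)

Section sections.
Context {R : realType}.
Local Notation mR := (measurableTypeR R).
Variables (k : nat) (s r b T : R).
Hypotheses (k0 : (0 < k)%N) (s0 : 0 < s) (r0 : 0 < r) (b1 : 1 <= b).
Local Notation H := (gg_profile k s).

Lemma measurable_ltr_set (f g : mR * mR -> mR) :
  measurable_fun setT f -> measurable_fun setT g ->
  measurable [set p | (f p : R) < g p].
Proof.
move=> mf mg.
have := measurable_fun_ltr mf mg measurableT (Y := [set true]) I.
by rewrite setTI.
Qed.

(* In both events p stands for (<e, delta>, |e|^2) with |delta| = r, so that the
   other squared norm is |e + delta|^2, respectively |e - delta|^2. *)
Definition shift_event (l1 l : R) : set (mR * mR) :=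
  [set p | H p.2 < (l1 + l * (p.2 + 2 * p.1 + r ^+ 2 <= T ^+ 2)%R%:R) *
                   H (p.2 + 2 * p.1 + r ^+ 2)].

Definition unshift_event (l1 l : R) : set (mR * mR) :=
  [set p | H (p.2 - 2 * p.1 + r ^+ 2) <
           (l1 + l * (p.2 <= T ^+ 2)%R%:R) * H p.2].

Let measurable_le (f : mR * mR -> mR) : measurable_fun setT f ->
  measurable_fun setT (fun p => ((f p : R) <= T ^+ 2)%R%:R : mR).
Proof.
move=> mf; rewrite (_ : (fun p => _) =
    (fun p => if ((f p : R) <= T ^+ 2)%R then 1 else 0)); last first.
  by apply/funext => x; case: ifP.
by apply: measurable_fun_ifT => //; exact: measurable_fun_ler.
Qed.

Lemma measurable_shift_event (l1 l : R) : measurable (shift_event l1 l).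
Proof.
have mH : measurable_fun [set: mR] (H : mR -> mR) by exact: measurable_gg_profile.
have mv : measurable_fun [set: mR * mR] (fun p : mR * mR =>
    (p.2 + 2 * p.1 + r ^+ 2)%R : mR).
  by apply: measurable_funD => //; apply: measurable_funD => //; exact: measurable_funM.
apply: measurable_ltr_set; first exact: measurableT_comp.
apply: measurable_funM; last exact: measurableT_comp mH mv.
apply: measurable_funD => //; apply: measurable_funM => //.
exact: (measurable_le mv).
Qed.

Lemma measurable_unshift_event (l1 l : R) : measurable (unshift_event l1 l).
Proof.
have mH : measurable_fun [set: mR] (H : mR -> mR) by exact: measurable_gg_profile.
have mv : measurable_fun [set: mR * mR] (fun p : mR * mR =>
    (p.2 - 2 * p.1 + r ^+ 2)%R : mR).
  by apply: measurable_funD => //; apply: measurable_funB => //; exact: measurable_funM.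
apply: measurable_ltr_set; first exact: measurableT_comp mH mv.
apply: measurable_funM; last exact: measurableT_comp.
apply: measurable_funD => //; apply: measurable_funM => //.
exact: (measurable_le (f := snd)).
Qed.

Variable t : R.
Hypothesis t0 : 0 < t.
Let rho := s * Num.sqrt (2 * t).

Let rho0 : 0 < rho. Proof. by rewrite mulr_gt0// sqrtr_gt0 mulr_gt0. Qed.

Let rho2 : 2 * s ^+ 2 * t = rho ^+ 2.
Proof. by rewrite exprMn sqr_sqrtr ?mulr_ge0 ?(ltW t0)//; ring. Qed.

Let q0 : 0 < 4 * r * rho. Proof. by rewrite mulr_gt0// mulr_gt0. Qed.

Let W (l : R) := 2 * s ^+ 2 * k%:R *
  lambertW (t / k%:R * expR (t / k%:R) * root_pos k l).

(** The inverse of [v] below, where [v y] is the squared norm of the shifted point when the cosine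
    is [2 * y - 1]. The arguments of the Beta distribution function in [u1] and [u2] have this
    form. *)
Let x (X : R) := (X - (rho - r) ^+ 2) / (4 * r * rho).

Let v y := (rho - r) ^+ 2 + 4 * r * rho * y.

Let v_gt0 y : 0 < y -> 0 < v y.
Proof. by move=> y0; rewrite /v ltr_wpDl ?sqr_ge0// mulr_gt0. Qed.

Let xE y X : (y <= x X) = (v y <= X).
Proof. by rewrite /x ler_pdivlMr// /v mulrC lerBrDl. Qed.

Let ltW_v y l : y != x (W l) -> (v y < W l) = (v y <= W l).
Proof.
move=> yx; rewrite lt_neqAle; suff -> : v y != W l by [].
by apply: contra yx => /eqP <-; rewrite /x /v addrC addKr mulrC mulKf// gt_eqF.
Qed.

Let shiftE l1 l y : 0 < y ->
  polar_section r s (shift_event l1 l) t y =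
  (v y < W (l1 + l * (v y <= T ^+ 2)%R%:R)) :> Prop.
Proof.
move=> y0; rewrite /polar_section /shift_event/= -/rho.
rewrite (_ : 2 * s ^+ 2 * t + 2 * (r * rho * (2 * y - 1)) + r ^+ 2 = v y).
  by rewrite gg_profile_lt_root_pos// v_gt0.
by rewrite rho2 /v; ring.
Qed.

Let W_le0 l : l <= 0 -> W l = 0.
Proof. by move=> l0; rewrite /W /root_pos ltNge l0/= mulr0 lambertW0 mulr0. Qed.

Local Open Scope ereal_scope.

(** Outside the ball the coefficient is [l1 <= 0] and the event is impossible; inside, both
    [v y <= T ^+ 2] and [v y < W (l1 + l)] are required, whence the minimum. *)
Lemma beta_shift_event_le0 (l1 l : R) : (l1 <= 0)%R ->
  real_beta_prob b b (polar_section r s (shift_event l1 l) t) =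
  (real_beta_cdf b b (x (Num.min (T ^+ 2) (W (l1 + l))))%:E)%:E.
Proof.
move=> l10; rewrite real_beta_cdfE//.
apply: (@real_beta_prob_eq _ _ _ (x (W (l1 + l))) (x (W (l1 + l)))).
- by apply: measurable_polar_section; exact: measurable_shift_event.
- exact: measurable_itv.
move=> y /andP[y0 y1] yx _; rewrite shiftE//= in_itv/= xE le_min.
case: (boolP (v y <= T ^+ 2)%R) => vT/=; first by rewrite mulr1 ltW_v.
by rewrite mulr0 addr0 W_le0// ltNge (ltW (v_gt0 y0)).
Qed.

(** Outside the ball a second piece appears, [T ^+ 2 < v y < W l1], disjoint from the one inside. *)
Lemma beta_shift_event_gt0 (l1 l : R) :
  real_beta_prob b b (polar_section r s (shift_event l1 l) t) =
  (real_beta_cdf b b (x (Num.min (T ^+ 2) (W (l1 + l))))%:E +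
   Num.max (real_beta_cdf b b (x (W l1))%:E - real_beta_cdf b b (x (T ^+ 2))%:E)
     0)%:E.
Proof.
set xm := x (Num.min _ _); set xT := x (T ^+ 2).
have mI (z : R) : measurable (`]-oo, z]%classic : set mR) by exact: measurable_itv.
have mxT : (xm <= xT)%R.
  by rewrite /xm /xT /x ler_pM2r ?invr_gt0// lerD2r ge_min lexx.
transitivity (real_beta_prob b b
    (`]-oo, xm]%classic `|` (`]-oo, x (W l1)]%classic `\` `]-oo, xT]%classic))).
  apply: (@real_beta_prob_eq _ _ _ (x (W (l1 + l))) (x (W l1))).
  - by apply: measurable_polar_section; exact: measurable_shift_event.
  - by apply: measurableU => //; exact: measurableD.
  move=> y /andP[y0 y1] yx1 yx2; rewrite shiftE//= !in_itv/= /xm !xE le_min.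
  case: (boolP (v y <= T ^+ 2)%R) => vT/=; rewrite ?mulr1 ?mulr0 ?addr0 ltW_v//.
    by split=> [h|[//|[_ []]]]; first by left.
  by split=> [h|[//|[]//]]; right.
transitivity (real_beta_prob b b `]-oo, xm]%classic +
    real_beta_prob b b (`]-oo, x (W l1)]%classic `\` `]-oo, xT]%classic)).
  apply: measureU => //; first exact: measurableD.
  apply/seteqP; split=> // y [] /=; rewrite !in_itv/= => yxm [_ []].
  exact: le_trans mxT.
rewrite EFinD real_beta_cdfE//; congr (_ + _).
(* Either the half-lines are nested and their measures subtract, or the second piece is empty and
   the maximum with 0 takes over. *)
have [Tx|xT'] := leP xT (x (W l1)).
  rewrite (_ : real_beta_prob b b _ = real_beta_prob b b `]-oo, x (W l1)]%classic -
      real_beta_prob b b `]-oo, xT]%classic); last first.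
    have fin : real_beta_prob b b `]-oo, x (W l1)]%classic < +oo.
      by rewrite ltey_eq; apply/orP; left; exact: real_beta_prob_fin.
    have D := measureD (mu := real_beta_prob b b) (mI (x (W l1))) (mI xT) fin.
    by apply: etrans D _; rewrite setIidr//; exact: subset_itvl.
  rewrite -!real_beta_cdfE// -EFinB max_l// subr_ge0 -lee_fin !real_beta_cdfE//.
  by apply: le_measure; rewrite ?inE//; exact: subset_itvl.
rewrite (_ : _ `\` _ = set0); last first.
  apply/seteqP; split=> // y [] /=; rewrite !in_itv/= => yW [].
  exact: le_trans yW (ltW xT').
rewrite [LHS]measure0 max_r// subr_le0 -lee_fin !real_beta_cdfE//.
by apply: le_measure; rewrite ?inE//; apply: subset_itvl; rewrite bnd_simp ltW.
Qed.

(** Here the truncation tests the point whose norm is fixed by [t], so the coefficient does not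
    depend on [y]. The other squared norm decreases in [y], which leaves one half-line. *)
Lemma beta_unshift_event (l1 l : R) :
  real_beta_prob b b (polar_section r s (unshift_event l1 l) t) =
  (real_beta_cdf b b
    ((((r + rho) ^+ 2)%:E
      - (2 * k%:R * s ^+ 2)%:E
        * er_map (@lambertW R) ((t / k%:R * expR (t / k%:R))%:E *
            inv_root_pos k (l1 + l * (2 * s ^+ 2 * t <= T ^+ 2)%R%:R)))
     * ((4 * r * rho)^-1)%:E))%:E.
Proof.
set lam := (l1 + _)%R.
have SE y : polar_section r s (unshift_event l1 l) t y =
    (H ((r + rho) ^+ 2 - 4 * r * rho * y) < lam * H (2 * s ^+ 2 * t))%R :> Prop.
  rewrite /polar_section /unshift_event/= -/rho -/lam.
  rewrite (_ : 2 * s ^+ 2 * t - 2 * (r * rho * (2 * y - 1)) + r ^+ 2 =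
    (r + rho) ^+ 2 - 4 * r * rho * y)%R//.
  by rewrite rho2; ring.
have vy (y : R) : (y < 1)%R -> (0 < (r + rho) ^+ 2 - 4 * r * rho * y)%R.
  move=> y1; rewrite (_ : _ - _ = (r - rho) ^+ 2 + 4 * r * rho * (1 - y))%R; last by ring.
  by rewrite ltr_wpDl ?sqr_ge0// mulr_gt0// subr_gt0.
(* For [lam <= 0] the value [+oo] passes through [er_map] and the subtraction to [-oo], where the
   distribution function is 0; the event is empty since the profile is nonnegative. *)
rewrite /inv_root_pos; case: ltP => l0; last first.
  rewrite gt0_muley; last first.
    by rewrite lte_fin mulr_gt0 ?expR_gt0// divr_gt0// ltr0n.
  rewrite /= gt0_muley; last by rewrite lte_fin !mulr_gt0 ?ltr0n ?exprn_gt0.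
  rewrite /= gt0_mulNye ?lte_fin ?invr_gt0// real_beta_cdfNy.
  rewrite (@real_beta_prob_eq _ _ _ 0 0 _ set0) ?measure0//.
  - by apply: measurable_polar_section; exact: measurable_unshift_event.
  move=> y _ _ _; rewrite SE; split=> // /(le_lt_trans (gg_profile_ge0 _ _ _)).
  by rewrite ltNge mulr_le0_ge0// gg_profile_ge0.
pose X := lambertW (t / k%:R * expR (t / k%:R) * lam `^ (- k%:R^-1)).
pose z := (((r + rho) ^+ 2 - 2 * k%:R * s ^+ 2 * X) / (4 * r * rho))%R.
rewrite -[X in real_beta_cdf b b X]/(z%:E) real_beta_cdfE//.
apply: (@real_beta_prob_eq _ _ _ z z).
- by apply: measurable_polar_section; exact: measurable_unshift_event.
- exact: measurable_itv.
move=> y /andP[y0 y1] yz _; rewrite SE gg_profile_lt_inv_root ?vy//= in_itv/=.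
rewrite -/X -/z le_eqVlt (negbTE yz)/= /z ltr_pdivlMr// (mulrC y).
by rewrite ltrBrDr ltrBrDr addrC.
Qed.

End sections.

(** * From densities to profiles *)

Section gg_events.
Context {R : realType} (n k : nat) (sigma T : R) (delta : 'rV[R]_n.+3).
Hypotheses (kd : k%:R < n.+3%:R / 2 :> R).
Hypotheses (sigma0 : 0 < sigma) (T0 : 0 < T).
Local Notation mR := (measurableTypeR R).
Local Notation d := n.+3.
Local Notation a := (d%:R / 2 - k%:R : R).
Local Notation b := (n.+2%:R / 2 : R).
Local Notation s := (gg_scale d k sigma).
Local Notation r := (l2norm delta).
Local Notation nu := ((gamma_cdf a (T ^+ 2 / (2 * s ^+ 2)))^-1).
Local Notation p := (gg_pdf (d := d) k sigma).
Local Notation q := (gg_trunc_pdf (d := d) k T sigma).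

Let Z0 : 0 < gg_total n k sigma. Proof. exact: gg_total_gt0. Qed.

(** All densities carry the factor [(gg_total n k sigma)^-1], which cancels; [q] contributes [nu]
    times the full density on the ball. *)
Lemma shift_eventE (l1 l2 : R) :
  [set e | p e < l1 * p (e + delta) + l2 * q (e + delta)] =
  [set e | shift_event k s r T l1 (nu * l2) (dotrV e delta, sqnorm e)].
Proof.
apply/seteqP; suff E e : (p e < l1 * p (e + delta) + l2 * q (e + delta)) =
    (gg_profile k s (sqnorm e) <
     (l1 + nu * l2 * (sqnorm e + 2 * dotrV e delta + r ^+ 2 <= T ^+ 2)%R%:R) *
     gg_profile k s (sqnorm e + 2 * dotrV e delta + r ^+ 2)).
  by split=> e /=; rewrite /shift_event/= E.
rewrite gg_trunc_pdfE// !gg_pdfE sqnormD !l2norm_sqr.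
rewrite -[in RHS](ltr_pM2r (x := (gg_total n k sigma)^-1)) ?invr_gt0//.
by congr (_ < _); ring.
Qed.

Lemma unshift_eventE (l1 l2 : R) :
  [set e | p (e - delta) < l1 * p e + l2 * q e] =
  [set e | unshift_event k s r T l1 (nu * l2) (dotrV e delta, sqnorm e)].
Proof.
apply/seteqP; suff E e : (p (e - delta) < l1 * p e + l2 * q e) =
    (gg_profile k s (sqnorm e - 2 * dotrV e delta + r ^+ 2) <
     (l1 + nu * l2 * (sqnorm e <= T ^+ 2)%R%:R) * gg_profile k s (sqnorm e)).
  by split=> e /=; rewrite /unshift_event/= E.
rewrite gg_trunc_pdfE// !gg_pdfE sqnormB !l2norm_sqr.
rewrite -[in RHS](ltr_pM2r (x := (gg_total n k sigma)^-1)) ?invr_gt0//.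
by congr (_ < _); ring.
Qed.

End gg_events.

Theorem theorem5 (R : realType) (d k : nat) (sigma T : R) (delta : 'rV[R]_d)
    (k_ge1 : (1 <= k)%N) (k_lt : k%:R < d%:R / 2 :> R)
    (sigma_gt0 : 0 < sigma) (T_gt0 : 0 < T) (delta_gt0 : 0 < l2norm delta) :
  let p : 'rV[R]_d -> R := gg_pdf k sigma in
  let q : 'rV[R]_d -> R := gg_trunc_pdf k T sigma in
  let PP : set 'rV[R]_d -> \bar R := gg_prob k sigma in
  let QQ : set 'rV[R]_d -> \bar R := gg_trunc_prob k T sigma in
  let r : R := l2norm delta in
  let s : R := gg_scale d k sigma in
  let a : R := d%:R / 2 - k%:R in
  let nu : R := (gamma_cdf a (T ^+ 2 / (2 * s ^+ 2)))^-1 in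
  let BetaCDF : \bar R -> R :=
    real_beta_cdf ((d%:R - 1) / 2) ((d%:R - 1) / 2) in
  let E (f : R -> R) : \bar R := (\int[gamma_prob a]_t (f t)%:E)%E in
  let prR (l1 l2 : R) : \bar R :=
    PP [set e | p e < l1 * p (e + delta) + l2 * q (e + delta)] in
  let prP (l1 l2 : R) : \bar R :=
    PP [set e | p (e - delta) < l1 * p e + l2 * q e] in
  let prQ (l1 l2 : R) : \bar R :=
    QQ [set e | p (e - delta) < l1 * p e + l2 * q e] in
  let rho (t : R) : R := s * Num.sqrt (2 * t) in
  let c (t : R) : R := t / k%:R * expR (t / k%:R) in
  let u1 (l1 l2 t : R) : R :=
    BetaCDF ((Num.min (T ^+ 2)
                (2 * s ^+ 2 * k%:R * lambertW (c t * root_pos k (l1 + nu * l2)))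
              - (rho t - r) ^+ 2) / (4 * r * rho t))%:E in
  let u2 (l1 t : R) : R :=
    Num.max
      (BetaCDF ((2 * s ^+ 2 * k%:R * lambertW (c t * root_pos k l1)
                 - (rho t - r) ^+ 2) / (4 * r * rho t))%:E
       - BetaCDF ((T ^+ 2 - (rho t - r) ^+ 2) / (4 * r * rho t))%:E)
      0 in
  let u3 (t l : R) : R :=
    BetaCDF ((((r + rho t) ^+ 2)%:E
              - (2 * k%:R * s ^+ 2)%:E
                * er_map lambertW ((c t)%:E * inv_root_pos k l))
             * ((4 * r * rho t)^-1)%:E)%E in
  forall l1 l2 : R,
  [/\ (l1 <= 0 -> prR l1 l2 = E (u1 l1 l2)),
      (0 < l1 -> prR l1 l2 = E (fun t => u1 l1 l2 t + u2 l1 t)%R),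
      prP l1 l2 =
        E (fun t => u3 t l1 * (T ^+ 2 / (2 * s ^+ 2) <= t)%R%:R
                    + u3 t (l1 + nu * l2) * (t < T ^+ 2 / (2 * s ^+ 2))%R%:R)%R
    & prQ l1 l2 =
        (nu%:E * E (fun t => u3 t (l1 + nu * l2)
                             * (t <= T ^+ 2 / (2 * s ^+ 2))%R%:R)%R)%E].
Proof.
have k1 : 1 <= k%:R :> R by rewrite ler1n.
(* Dimensions 0, 1 and 2 contradict [1 <= k < d / 2]. *)
case: d delta k_lt delta_gt0 => [|[|[|n]]] delta k_lt delta_gt0; [lra..|].
move=> p q PP QQ r s a nu BetaCDF E prR prP prQ rho c u1 u2 u3 l1 l2.
pose b : R := n.+2%:R / 2.
have bE : (n.+3%:R - 1) / 2 = b by rewrite /b -[n.+3%:R]natr1 addrK.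
have b1 : 1 <= b := beta_shape_ge1 n.
have BE x : BetaCDF x = real_beta_cdf b b x by rewrite /BetaCDF bE.
have B0 x : 0 <= BetaCDF x by rewrite BE real_beta_cdf_ge0.
have B00 : BetaCDF 0%E = 0 by rewrite BE real_beta_cdf_le0.
have s0 : 0 < s by exact: gg_scale_gt0.
(* For t <= 0 the radius vanishes and division by 0 makes u1, u2 and u3 vanish. *)
have rho_le0 t : t <= 0 -> (4 * r * rho t)^-1 = 0.
  by move=> t0; rewrite /rho ler0_sqrtr ?mulr0 ?invr0// pmulr_rle0.
have msec Phi : measurable Phi -> measurable_fun [set: measurableTypeR R]
    (fun t : measurableTypeR R => real_beta_prob b b (polar_section r s Phi t)).
  exact: measurable_real_beta_polar_section.
have mPhi := measurable_shift_event k s r T l1 (nu * l2).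
have mPsi := measurable_unshift_event k s r T l1 (nu * l2).
have u1_ge0 t : 0 <= u1 l1 l2 t by exact: B0.
have u1_le0 t : t <= 0 -> u1 l1 l2 t = 0 by move=> t0; rewrite /u1 rho_le0// mulr0.
have u2_le0 t : t <= 0 -> u2 l1 t = 0.
  by move=> t0; rewrite /u2 rho_le0// !mulr0 subrr maxxx.
have u3_le0 t l : t <= 0 -> u3 t l = 0.
  by move=> t0; rewrite /u3 rho_le0// mule0.
have prR_E : prR l1 l2 = (\int[gamma_prob a]_t
    real_beta_prob b b (polar_section r s (shift_event k s r T l1 (nu * l2)) t))%E.
  by rewrite /prR shift_eventE//; exact: gg_probE.
have tT t : (2 * s ^+ 2 * t <= T ^+ 2) = (t <= T ^+ 2 / (2 * s ^+ 2)).
  rewrite ler_pdivlMr; first by rewrite mulrC.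
  by apply: mulr_gt0 => //; exact: exprn_gt0.
have u3_ge0 t l : 0 <= u3 t l by exact: B0.
have u3E t : 0 < t ->
  real_beta_prob b b (polar_section r s (unshift_event k s r T l1 (nu * l2)) t) =
  (u3 t (l1 + nu * l2 * (t <= T ^+ 2 / (2 * s ^+ 2))%R%:R))%:E.
  move=> t0; rewrite -tT /u3 BE; exact: beta_unshift_event.
split.
(* There is no exceptional [t] here; 0 is a placeholder already excluded by [0 < t]. *)
- move=> l10; rewrite prR_E; apply: (@ge0_integral_gamma_eq R a 0) => //.
  + exact: msec.
  + by move=> t t0 _; rewrite /u1 BE; exact: beta_shift_event_le0.
- move=> l10; rewrite prR_E; apply: (@ge0_integral_gamma_eq R a 0) => //.
  + exact: msec.
  + by move=> t; rewrite addr_ge0// le_max lexx orbT.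
  + by move=> t t0 _; rewrite /u1 /u2 !BE; exact: beta_shift_event_gt0.
  + by move=> t t0; rewrite u1_le0// u2_le0// addr0.
- have -> : prP l1 l2 = (\int[gamma_prob a]_t
      real_beta_prob b b (polar_section r s (unshift_event k s r T l1 (nu * l2)) t))%E.
    have ev := unshift_eventE delta k_lt sigma_gt0 T_gt0 l1 l2.
    apply: etrans (congr1 PP ev) _.
    have h := gg_probE k_lt sigma_gt0 delta mPsi.
    exact: h.
  (* On the sphere of radius [T] the event has coefficient [l1 + nu * l2], whereas the formula takes
     [l1]; this single [t] is the exceptional point. *)
  apply: (@ge0_integral_gamma_eq R a (T ^+ 2 / (2 * s ^+ 2))) => //.
  + exact: msec.
  + by move=> t; rewrite addr_ge0// mulr_ge0.
  + move=> t t0 tc; rewrite u3E//; congr _%:E.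
    generalize (u3 t) => g.
    case: (ltgtP t (T ^+ 2 / (2 * s ^+ 2))) tc => // _ _.
      by rewrite mulr0 add0r !mulr1.
    by rewrite !mulr0 addr0 mulr1 addr0.
  + by move=> t t0; rewrite !u3_le0// !mul0r addr0.
(* The ball becomes part of the event. Its section at [t] is that of the unshifted event up to the
   threshold and empty beyond it. *)
- pose Psi : set (measurableTypeR R * measurableTypeR R) :=
    unshift_event k s r T l1 (nu * l2) `&` [set z | z.2 <= T ^+ 2].
  have mPsi' : measurable Psi.
    apply: measurableI => //.
    rewrite (_ : [set z | _] = snd @^-1` `]-oo, T ^+ 2]); last first.
      by apply/seteqP; split=> z /=; rewrite in_itv.
    rewrite -[X in measurable X]setTI.
    exact: (@measurable_snd _ _ (measurableTypeR R) (measurableTypeR R) measurableT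
      _ (measurable_itv _)).
  rewrite /prQ unshift_eventE// /QQ gg_trunc_probE//; last first.
    rewrite -[X in measurable X]setTI.
    exact: (@measurable_dot_sqnorm R _ delta measurableT _ mPsi).
  congr (_ * _)%E.
  rewrite (_ : _ `&` _ = [set e | Psi (dotrV e delta, sqnorm e)])//.
  rewrite gg_probE//; apply: (@ge0_integral_gamma_eq R a 0) => //.
  + exact: msec.
  + by move=> t; rewrite mulr_ge0.
  + move=> t t0 _; case: (boolP (t <= T ^+ 2 / (2 * s ^+ 2))) => tc.
      rewrite mulr1; have := u3E t t0; rewrite tc mulr1 => <-.
      congr (real_beta_prob _ _ _); apply/seteqP; split=> y; first by case.
      by move=> h; split=> //=; rewrite tT.
    rewrite mulr0 -[RHS](measure0 (real_beta_prob b b)).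
    congr (real_beta_prob _ _ _); apply/seteqP; split=> y // -[_ /=].
    by rewrite tT (negbTE tc).
  + by move=> t t0; rewrite u3_le0// mul0r.
Qed.
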